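(* Let $(M,\phi,\xi,\eta,g)$ be an almost $\alpha$-cosymplectic $3$-manifold admitting a contact Einstein soliton, i.e. there is a constant $\lambda\in\mathbb{R}$ with $\mathfrak{L}_\xi g+2S=(2\lambda+r)g$. For a local $\phi$-basis $(e,\phi e,\xi)$ with $he=\sigma e$, let $a=g(\nabla_e\phi e,e)$ and $b=-g(\nabla_{\phi e}e,\phi e)$. Then the following hold. (1) Where $\sigma\neq 0$, one has $\alpha=a^2+b^2-2\sigma^2+(\phi e)(a)-e(b)$. (2) If $\sigma=0$ (identically, i.e. $h=0$ on $M$), then $M$ is cosymplectic.
   Context: An almost contact metric manifold $(M^{2n+1},\phi,\xi,\eta,g)$ is a Riemannian manifold $(M,g)$ with a $(1,1)$-tensor $\phi$, a global vector field $\xi$ (the characteristic or Reeb vector field) and a $1$-form $\eta$ such that $\phi^2X=-X+\eta(X)\xi$, $\eta(\xi)=1$ and $g(\phi X,\phi Y)=g(X,Y)-\eta(X)\eta(Y)$ for all vector fields $X,Y$. Put $\Phi(X,Y)=g(\phi X,Y)$. It is an almost $\alpha$-cosymplectic manifold if $d\eta=0$ and $d\Phi=2\alpha\,\eta\wedge\Phi$ for a constant $\alpha\in\mathbb{R}$. It is cosymplectic if $\eta$ and $\Phi$ are both closed and $\eta\wedge\Phi^n$ is a volume element. Put $h=\frac12\mathfrak{L}_\xi\phi$, where $\mathfrak{L}$ denotes the Lie derivative. In dimension $3$ a $\phi$-basis is a local orthonormal frame $(e,\phi e,\xi)$ with $he=\sigma e$, $h\phi e=-\sigma\phi e$, $h\xi=0$,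 where $\sigma$ is a local smooth eigenfunction of $h$. $\nabla$ is the Levi-Civita connection, $S$ the Ricci tensor, and $r$ the scalar curvature. An Einstein soliton with potential vector field $V$ is a solution of $\mathfrak{L}_Vg+2S=(2\lambda+r)g$ with $\lambda\in\mathbb{R}$ constant; on an almost contact metric manifold it is called a contact Einstein soliton if $V=\xi$. For a vector field $X$ and a function $f$, $X(f)$ is the derivative of $f$ along $X$. *)

(* Defs.v *)
From HB Require Import structures.
From mathcomp Require Import all_boot all_order all_algebra.
From mathcomp Require Import all_classical all_reals all_analysis.

Set Implicit Arguments.
Unset Strict Implicit.
Unset Printing Implicit Defensive.

Import Order.TTheory GRing.Theory Num.Theory.
Import numFieldNormedType.Exports.

Local Open Scope classical_set_scope.
Local Open Scope ring_scope.

(* C^oo on an open set [D]: all iterated directional derivatives exist and are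
   (Frechet) differentiable at every point of [D]. *)
Definition smooth_on (R : realType) (m : nat) (D : set 'rV[R]_m)
    (f : 'rV[R]_m -> R) : Prop :=
  forall (vs : seq 'rV[R]_m) (x : 'rV[R]_m), D x ->
    differentiable (foldr (fun v k => 'D_v k) f vs) x.

(* [cmap] only matters on [cdom], and [cinv] only on the image of [cdom]. *)
Record chart (R : realType) (m : nat) (M : topologicalType) := Chart {
  cdom : set M ;
  cmap : M -> 'rV[R]_m ;
  cinv : 'rV[R]_m -> M ;
  cdom_open : open cdom ;
  cimg_open : open (cmap @` cdom) ;
  cmapK : forall p, cdom p -> cinv (cmap p) = p ;
  cmap_continuous : forall p, cdom p -> {for p, continuous cmap} ;
  cinv_continuous : forall p, cdom p -> {for cmap p, continuous cinv} }.

Record manifold (R : realType) (m : nat) := Manifold {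
  carrier :> topologicalType ;
  atlas : set (chart R m carrier) ;
  manifold_hausdorff : hausdorff_space carrier ;
  manifold_second_countable : @second_countable carrier ;
  atlas_cover : forall p : carrier, exists2 c, atlas c & cdom c p ;
  atlas_compatible : forall c c', atlas c -> atlas c' -> forall j : 'I_m,
    smooth_on (cmap c @` (cdom c `&` cdom c'))
              (fun x => cmap c' (cinv c x) ord0 j) }.

Section Calculus.
Context {R : realType} {m : nat} (M : manifold R m).

Definition smooth (U : set M) (f : M -> R) : Prop :=
  forall c, atlas c -> smooth_on (cmap c @` (cdom c `&` U)) (f \o cinv c).

Definition smooth_at (p : M) (f : M -> R) : Prop :=
  exists U : set M, [/\ open U, U p & smooth U f].

(* A tangent vector at [p] is the operator f |-> sum_i w_i (d f/d x^i)(p) in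
   some chart around [p].  It is given the value 0 on the functions that are not
   smooth near [p], so that equality of tangent vectors is Leibniz equality. *)
Definition tvec : Type := (M -> R) -> R.

Definition tangent (p : M) (v : tvec) : Prop :=
  exists c (w : 'rV[R]_m), [/\ atlas c, cdom c p & forall f : M -> R,
    v f = if `[< smooth_at p f >] then 'D_w (f \o cinv c) (cmap c p) else 0].

(* Vector fields and tensors are total functions on [M]; a local vector field on
   an open set [U] is only constrained (and only ever used) at points of [U]. *)
Definition vfield : Type := M -> tvec.

Definition dir (X : vfield) (f : M -> R) : M -> R := fun p => X p f.

Definition vfield_on (U : set M) (X : vfield) : Prop :=
  (forall p, U p -> tangent p (X p)) /\
  (forall (W : set M) (f : M -> R), open W -> W `<=` U ->
     smooth W f -> smooth W (dir X f)).

Definition bracket (X Y : vfield) : vfield := fun p f =>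
  if `[< smooth_at p f >] then dir X (dir Y f) p - dir Y (dir X f) p else 0.

Definition tensor11 : Type := M -> tvec -> tvec.
Definition form1 : Type := M -> tvec -> R.
Definition form2 : Type := M -> tvec -> tvec -> R.

Definition tapp (phi : tensor11) (X : vfield) : vfield := fun p => phi p (X p).
Definition f1app (eta : form1) (X : vfield) : M -> R := fun p => eta p (X p).
Definition f2app (b : form2) (X Y : vfield) : M -> R :=
  fun p => b p (X p) (Y p).

Definition is_tensor11 (phi : tensor11) : Prop :=
  [/\ forall p u, tangent p u -> tangent p (phi p u),
      forall p (a : R) u v, tangent p u -> tangent p v ->
        phi p (a *: u + v) = a *: phi p u + phi p v &
      forall (U : set M) X, open U -> vfield_on U X ->
        vfield_on U (tapp phi X)].

Definition is_form1 (eta : form1) : Prop :=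
  (forall p (a : R) u v, tangent p u -> tangent p v ->
     eta p (a *: u + v) = a * eta p u + eta p v) /\
  (forall (U : set M) X, open U -> vfield_on U X -> smooth U (f1app eta X)).

Definition riemannian_metric (g : form2) : Prop :=
  [/\ forall p u v, tangent p u -> tangent p v -> g p u v = g p v u,
      forall p (a : R) u v w, tangent p u -> tangent p v -> tangent p w ->
        g p (a *: u + v) w = a * g p u w + g p v w,
      forall p u, tangent p u -> u <> 0 -> 0 < g p u u &
      forall (U : set M) X Y, open U -> vfield_on U X -> vfield_on U Y ->
        smooth U (f2app g X Y)].

(* Exterior derivative and wedge product, in the convention without the factors
   1/(k+1) and 1/3 (respectively).  Using the factors in both places gives the
   same equation d Phi = 2 alpha eta /\ Phi. *)
Definition d1 (eta : form1) (X Y : vfield) : M -> R := fun p =>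
  dir X (f1app eta Y) p - dir Y (f1app eta X) p - f1app eta (bracket X Y) p.

Definition d2 (b : form2) (X Y Z : vfield) : M -> R := fun p =>
  dir X (f2app b Y Z) p - dir Y (f2app b X Z) p + dir Z (f2app b X Y) p
  - f2app b (bracket X Y) Z p + f2app b (bracket X Z) Y p
  - f2app b (bracket Y Z) X p.

Definition wedge12 (eta : form1) (b : form2) (p : M) (u v w : tvec) : R :=
  eta p u * b p v w + eta p v * b p w u + eta p w * b p u v.

Definition closed1 (eta : form1) : Prop :=
  forall (U : set M) X Y, open U -> vfield_on U X -> vfield_on U Y ->
  forall p, U p -> d1 eta X Y p = 0.

Definition closed2 (b : form2) : Prop :=
  forall (U : set M) X Y Z, open U ->
    vfield_on U X -> vfield_on U Y -> vfield_on U Z ->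
  forall p, U p -> d2 b X Y Z p = 0.

Definition lie_tensor11 (V : vfield) (phi : tensor11) (X : vfield) : vfield :=
  fun p => bracket V (tapp phi X) p - phi p (bracket V X p).

Definition lie_form2 (V : vfield) (b : form2) (X Y : vfield) : M -> R :=
  fun p => dir V (f2app b X Y) p
           - f2app b (bracket V X) Y p - f2app b X (bracket V Y) p.

(* [nabla X Y] is the covariant derivative of [Y] along [X].  Since local
   vector fields are allowed, locality is part of the definition. *)
Definition affine_connection (nabla : vfield -> vfield -> vfield) : Prop :=
  [/\ forall (U : set M) X Y, open U -> vfield_on U X -> vfield_on U Y ->
        vfield_on U (nabla X Y),
      forall (U : set M) X X' Y Y', open U ->
        vfield_on U X -> vfield_on U X' -> vfield_on U Y -> vfield_on U Y' ->
        (forall p, U p -> X p = X' p) -> (forall p, U p -> Y p = Y' p) ->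
        forall p, U p -> nabla X Y p = nabla X' Y' p,
      forall (U : set M) (f : M -> R) X X' Y, open U -> smooth U f ->
        vfield_on U X -> vfield_on U X' -> vfield_on U Y ->
        forall p, U p ->
          nabla (fun q => f q *: X q + X' q) Y p
          = f p *: nabla X Y p + nabla X' Y p &
      forall (U : set M) (f : M -> R) X Y Y', open U -> smooth U f ->
        vfield_on U X -> vfield_on U Y -> vfield_on U Y' ->
        forall p, U p ->
          nabla X (fun q => f q *: Y q + Y' q) p
          = dir X f p *: Y p + f p *: nabla X Y p + nabla X Y' p].

Definition levi_civita (g : form2) (nabla : vfield -> vfield -> vfield) : Prop :=
  [/\ affine_connection nabla,
      forall (U : set M) X Y, open U -> vfield_on U X -> vfield_on U Y ->
        forall p, U p -> nabla X Y p - nabla Y X p = bracket X Y p &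
      forall (U : set M) X Y Z, open U ->
        vfield_on U X -> vfield_on U Y -> vfield_on U Z ->
        forall p, U p ->
          dir X (f2app g Y Z) p
          = f2app g (nabla X Y) Z p + f2app g Y (nabla X Z) p].

Definition curvature (nabla : vfield -> vfield -> vfield) (X Y Z : vfield)
    : vfield :=
  fun p => nabla X (nabla Y Z) p - nabla Y (nabla X Z) p
           - nabla (bracket X Y) Z p.

Definition orthonormal_at (g : form2) (p : M) (E : 'I_m -> tvec) : Prop :=
  (forall i, tangent p (E i)) /\
  (forall i j, g p (E i) (E j) = (i == j)%:R).

Definition orthonormal_frame (g : form2) (U : set M) (E : 'I_m -> vfield)
    : Prop :=
  (forall i, vfield_on U (E i)) /\
  (forall p, U p -> orthonormal_at g p (fun i => E i p)).

(* S(X, Y) is the trace of Z |-> R(Z, X) Y, computed in orthonormal frames. *)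
Definition ricci_tensor (g : form2) (nabla : vfield -> vfield -> vfield)
    (S : form2) : Prop :=
  forall (U : set M) (E : 'I_m -> vfield) X Y, open U ->
    orthonormal_frame g U E -> vfield_on U X -> vfield_on U Y ->
  forall p, U p ->
    S p (X p) (Y p) = \sum_(i < m) f2app g (curvature nabla (E i) X Y) (E i) p.

Definition scalar_curvature (g S : form2) (r : M -> R) : Prop :=
  forall p (E : 'I_m -> tvec), orthonormal_at g p E ->
    r p = \sum_(i < m) S p (E i) (E i).

Definition einstein_soliton (g S : form2) (r : M -> R) (V : vfield)
    (lambda : R) : Prop :=
  forall (U : set M) X Y, open U -> vfield_on U X -> vfield_on U Y ->
  forall p, U p ->
    lie_form2 V g X Y p + 2 * f2app S X Y p
    = (2 * lambda + r p) * f2app g X Y p.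

Definition almost_contact_metric (phi : tensor11) (xi : vfield) (eta : form1)
    (g : form2) : Prop :=
  [/\ is_tensor11 phi, vfield_on setT xi, is_form1 eta & riemannian_metric g] /\
  [/\ forall p u, tangent p u -> phi p (phi p u) = - u + eta p u *: xi p,
      forall p, eta p (xi p) = 1 &
      forall p u v, tangent p u -> tangent p v ->
        g p (phi p u) (phi p v) = g p u v - eta p u * eta p v].

Definition fundamental2 (phi : tensor11) (g : form2) : form2 :=
  fun p u v => g p (phi p u) v.

Definition almost_alpha_cosymplectic (phi : tensor11) (xi : vfield)
    (eta : form1) (g : form2) (alpha : R) : Prop :=
  [/\ almost_contact_metric phi xi eta g,
      closed1 eta &
      forall (U : set M) X Y Z, open U ->
        vfield_on U X -> vfield_on U Y -> vfield_on U Z ->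
      forall p, U p ->
        d2 (fundamental2 phi g) X Y Z p
        = 2 * alpha * wedge12 eta (fundamental2 phi g) p (X p) (Y p) (Z p)].

Definition htensor (phi : tensor11) (xi : vfield) (X : vfield) : vfield :=
  fun p => 2^-1 *: lie_tensor11 xi phi X p.

Definition contact_einstein_soliton (g S : form2) (r : M -> R) (xi : vfield)
    (lambda : R) : Prop :=
  einstein_soliton g S r xi lambda.

End Calculus.

Section DimensionThree.
Context {R : realType} (M : manifold R 3).

(* In dimension 2n+1 = 3 the form eta /\ Phi^n is eta /\ Phi; a 3-form on a
   3-manifold is a volume element when it vanishes at no point. *)
Definition volume_element (omega : M -> tvec M -> tvec M -> tvec M -> R)
    : Prop :=
  forall p, exists u v w,
    [/\ tangent p u, tangent p v, tangent p w & omega p u v w != 0].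

Definition cosymplectic3 (phi : tensor11 M) (xi : vfield M) (eta : form1 M)
    (g : form2 M) : Prop :=
  [/\ almost_contact_metric phi xi eta g,
      closed1 eta,
      closed2 (fundamental2 phi g) &
      volume_element (wedge12 eta (fundamental2 phi g))].

Definition phi_basis (phi : tensor11 M) (xi : vfield M) (g : form2 M)
    (U : set M) (e : vfield M) (sigma : M -> R) : Prop :=
  [/\ open U,
      orthonormal_frame g U
        (fun i : 'I_3 => nth xi [:: e; tapp phi e; xi] i),
      smooth U sigma &
      forall p, U p ->
        [/\ htensor phi xi e p = sigma p *: e p,
            htensor phi xi (tapp phi e) p = - (sigma p *: phi p (e p)) &
            htensor phi xi xi p = 0]].

End DimensionThree.

(* Main.v *)
Require Import Defs.
From HB Require Import structures.
From mathcomp Require Import all_boot all_order all_algebra.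
From mathcomp Require Import all_classical all_reals all_analysis.
From mathcomp Require Import ring lra.
Import Order.TTheory GRing.Theory Num.Theory.
Import numFieldNormedType.Exports.
Local Open Scope classical_set_scope.
Local Open Scope ring_scope.

Set Implicit Arguments.
Unset Strict Implicit.
Unset Printing Implicit Defensive.

(** Let E0 = e, E1 = phi e, E2 = xi be a phi-frame and write
    G i j k = g(nabla_Ei Ej, Ek).

    The closedness of eta, the equation d Phi = 2 alpha eta /\ Phi and
    h e = sigma e are first-order equations on the brackets of the frame.
    Together with the antisymmetry of G in its last two indices they determine
    every G i j k except a = G 0 1 0, b = - G 1 0 1 and w = G 2 0 1; in
    particular nabla_e xi = alpha e - sigma phi e and
    nabla_{phi e} xi = alpha phi e - sigma e ([christoffelE]).
    The trace of the soliton equation makes r = 4 alpha - 6 lambda, hence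
    S(xi, xi) = 2 alpha - 2 lambda and
    S(e, e) = S(phi e, phi e) = alpha - 2 lambda.

    On the other hand the curvature is an explicit expression in G and its
    derivatives along the frame ([curvature_coord]).  It gives
    S(xi, xi) = - 2 (alpha^2 + sigma^2), and it gives
    S(e, e) + S(phi e, phi e) - S(xi, xi), which is twice the sectional
    curvature of the plane orthogonal to xi, as
    2 (e(b) - (phi e)(a) - alpha^2 + sigma^2 - a^2 - b^2).
    Comparing with the soliton values yields
    alpha = a^2 + b^2 - 2 sigma^2 + (phi e)(a) - e(b) ([soliton_identity]),
    which is the first assertion.

    For the second one, let sigma = 0.  The soliton equation says S(xi, e) = 0 and
    S(xi, phi e) = 0, which read as formulas for xi(a) and xi(b)
    ([xi_connection_coef]).  With them and the commutators of the frame, the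
    function K = a^2 + b^2 + (phi e)(a) - e(b) satisfies xi(K) = - 2 alpha K.
    But K is the constant alpha by the above, so alpha^2 = 0 and d Phi = 0
    ([alpha_eq0]).  Geometrically, - K is the intrinsic curvature of the leaves
    of the kernel of eta, which the flow of xi rescales by exp (- 2 alpha t).
    This uses one phi-frame near each point ([local_phi_frame]), obtained by
    normalising the horizontal part of a coordinate field.

    Everything else is calculus on the manifold: smooth functions are stable
    under products, composition and reciprocal square roots ([smooth_on_gen]);
    the tangent vectors at a point form a vector space in which an orthonormal
    family indexed by the dimension is a basis ([orthonormal_expansion]); and
    the bracket of two vector fields is a vector field because it is
    nabla_X Y - nabla_Y X ([bracket_on]). *)

(** * Smooth functions on open subsets of R^m *)

Lemma open_near (T : topologicalType) (D : set T) (x : T) (P : T -> Prop) :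
  open D -> D x -> (forall y, D y -> P y) -> \forall y \near x, P y.
Proof.
move=> oD Dx DP; apply: filterS DP _; exact: open_nbhs_nbhs.
Qed.

(** Differentiability is local: the remainder f - f(x) - df has the same germ
    for both functions, so the differential of f serves for g. *)
Lemma near_eq_differentiable (R : numFieldType) (V W : normedModType R)
    (f g : V -> W) (x : V) :
  (\forall y \near x, f y = g y) -> differentiable f x -> differentiable g x.
Proof.
move=> fg df; have [df_cont /eqaddoP dfE] := (diff_locallyP x f).1 df.
have fgx : f x = g x := nbhs_singleton fg.
have gE : g \o shift x = cst (g x) + 'd f x +o_ 0 id.
  move: fg; rewrite (near_shift 0 x) subr0 => fg.
  apply/eqaddoP => e e0; near=> y.
  have -> : (g \o shift x - (cst (g x) + 'd f x)) y
          = (f \o shift x - (cst (f x) + 'd f x)) y.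
    rewrite /GRing.add /GRing.opp /= fgx; congr (_ - _).
    by apply/esym; near: y.
  by near: y; exact: dfE.
have dgE : 'd g x = 'd f x :> (V -> W) by exact: diff_unique.
by apply/diff_locallyP; rewrite dgE.
Unshelve. all: by end_near. Qed.

Section SmoothOn.
Context {R : realType} {m : nat}.
Implicit Types (D E : set 'rV[R]_m) (f g : 'rV[R]_m -> R).

Lemma differentiable_near_on D f g x : open D -> D x ->
  (forall y, D y -> f y = g y) -> differentiable f x -> differentiable g x.
Proof.
by move=> oD Dx fg; apply: near_eq_differentiable; exact: open_near fg.
Qed.

Lemma derive_near_on D f g x v : open D -> D x ->
  (forall y, D y -> f y = g y) -> 'D_v f x = 'D_v g x.
Proof. by move=> oD Dx fg; apply: near_eq_derive; exact: open_near fg. Qed.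

Lemma deriveM_at f g x v : differentiable f x -> differentiable g x ->
  'D_v (fun y => f y * g y) x = f x * 'D_v g x + g x * 'D_v f x.
Proof. by move=> df dg; rewrite (@deriveM _ _ f g) //; exact: diff_derivable. Qed.

Lemma smooth_on_diff D f x : smooth_on D f -> D x -> differentiable f x.
Proof. by move=> sf Dx; exact: (sf [::]). Qed.

Lemma smooth_on_derive D f v : smooth_on D f -> smooth_on D ('D_v f).
Proof. by move=> sf vs x Dx; have := sf (rcons vs v) x Dx; rewrite foldr_rcons. Qed.

Lemma smooth_on_sub D E f : D `<=` E -> smooth_on E f -> smooth_on D f.
Proof. by move=> DE sf vs x /DE; exact: sf. Qed.

(** The algebra of functions on D generated by B, up to equality on D. It
    serves to prove smoothness: iterated derivatives of a product or of a
    composite stay in such an algebra. *)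
Inductive gen_alg D (B : ('rV[R]_m -> R) -> Prop) : ('rV[R]_m -> R) -> Prop :=
| gen_base f of B f : gen_alg D B f
| gen_cst (c : R) : gen_alg D B (fun=> c)
| gen_add f g of gen_alg D B f & gen_alg D B g : gen_alg D B (fun x => f x + g x)
| gen_mul f g of gen_alg D B f & gen_alg D B g : gen_alg D B (fun x => f x * g x)
| gen_eq f g of (forall x, D x -> f x = g x) & gen_alg D B f : gen_alg D B g.

Lemma gen_alg_sum D B n (F : 'I_n -> 'rV[R]_m -> R) :
  (forall i, gen_alg D B (F i)) -> gen_alg D B (fun x => \sum_i F i x).
Proof.
elim: n F => [|n IHn] F BF.
  apply: gen_eq (gen_cst _ _ 0) => x _; by rewrite big_ord0.
apply: (@gen_eq _ _ (fun x => F ord0 x + \sum_i F (lift ord0 i) x)).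
  by move=> x _; rewrite big_ord_recl.
by apply: gen_add => //; exact: IHn.
Qed.

(** By the Leibniz rule, an algebra is stable under the derivations 'D_v as
    soon as the derivatives of its generators belong to it; then all iterated
    derivatives of its members are differentiable, because its generators are.
    *)
Lemma smooth_on_gen D (B : ('rV[R]_m -> R) -> Prop) : open D ->
  (forall b x, B b -> D x -> differentiable b x) ->
  (forall b v, B b -> gen_alg D B ('D_v b)) ->
  forall f, gen_alg D B f -> smooth_on D f.
Proof.
move=> oD diffB derB.
have diffG f : gen_alg D B f -> forall x, D x -> differentiable f x.
  elim=> {f} [f Bf x Dx|c x Dx|f g _ df _ dg x Dx|f g _ df _ dg x Dx|f g fg _ df x Dx].
  - exact: diffB.
  - exact: differentiable_cst.
  - exact: differentiableD (df x Dx) (dg x Dx).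
  - exact: differentiableM (df x Dx) (dg x Dx).
  - exact: differentiable_near_on oD Dx fg (df x Dx).
have derG f : gen_alg D B f -> forall v, gen_alg D B ('D_v f).
  elim=> {f} [f Bf v|c v|f g Gf df Gg dg v|f g Gf df Gg dg v|f g fg Gf df v].
  - exact: derB.
  - by apply: gen_eq (gen_cst _ _ 0) => x _; rewrite derive_cst.
  - apply: gen_eq (gen_add (df v) (dg v)) => x Dx.
    by rewrite (@deriveD _ _ _ f g) //; apply/diff_derivable/diffG.
  - apply: gen_eq (gen_add (gen_mul Gf (dg v)) (gen_mul Gg (df v))) => x Dx.
    by rewrite deriveM_at //; exact: diffG.
  - by apply: gen_eq (df v) => x Dx; exact: derive_near_on fg.
move=> f Gf vs x Dx; apply: diffG Dx.
by elim/last_ind: vs f Gf => [//|vs v IH] f Gf; rewrite foldr_rcons; apply/IH/derG.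
Qed.

Lemma smooth_on_smooth_gen D f : open D ->
  gen_alg D (smooth_on D) f -> smooth_on D f.
Proof.
move=> oD; apply: smooth_on_gen => // [b x|b v sb]; first exact: smooth_on_diff.
exact/gen_base/smooth_on_derive.
Qed.

Lemma smooth_on_eq D f g : open D -> (forall x, D x -> f x = g x) ->
  smooth_on D f -> smooth_on D g.
Proof.
by move=> oD fg sf; apply: smooth_on_smooth_gen => //; exact/(gen_eq fg)/gen_base.
Qed.

Lemma smooth_on_cst D (c : R) : open D -> smooth_on D (fun=> c).
Proof. by move=> oD; apply: smooth_on_smooth_gen => //; exact: gen_cst. Qed.

Lemma smooth_onD D f g : open D -> smooth_on D f -> smooth_on D g ->
  smooth_on D (fun x => f x + g x).
Proof.
by move=> oD sf sg; apply: smooth_on_smooth_gen => //; apply: gen_add; exact: gen_base.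
Qed.

Lemma smooth_onM D f g : open D -> smooth_on D f -> smooth_on D g ->
  smooth_on D (fun x => f x * g x).
Proof.
by move=> oD sf sg; apply: smooth_on_smooth_gen => //; apply: gen_mul; exact: gen_base.
Qed.

Lemma differentiable_rV (phi : 'rV[R]_m -> 'rV[R]_m) x :
  (forall j, differentiable (fun y => phi y ord0 j) x) -> differentiable phi x.
Proof.
move=> dphi.
have -> : phi = \sum_j (fun y => phi y ord0 j *: delta_mx ord0 j).
  apply/funext => y; rewrite fct_sumE; exact: row_sum_delta.
apply: differentiable_sum => j.
exact: differentiableZl.
Qed.

Lemma derive_comp_partials (phi : 'rV[R]_m -> 'rV[R]_m) f x v :
  (forall j, differentiable (fun y => phi y ord0 j) x) ->
  differentiable f (phi x) ->
  'D_v (f \o phi) x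
  = \sum_j 'D_(delta_mx ord0 j) f (phi x) * 'D_v (fun y => phi y ord0 j) x.
Proof.
move=> dphi df; have dp := differentiable_rV dphi.
rewrite deriveE; last exact: differentiable_comp.
rewrite diff_comp //= -(deriveE v dp) derive_mx; last exact: diff_derivable.
rewrite [X in 'd _ _ X]row_sum_delta linear_sum; apply: eq_bigr => j _.
by rewrite linearZ /= -deriveE // mxE mulrC.
Qed.

Lemma derive_comp (phi : 'rV[R]_m -> 'rV[R]_m) f x v :
  (forall j, differentiable (fun y => phi y ord0 j) x) ->
  differentiable f (phi x) -> 'D_v (f \o phi) x = 'D_('D_v phi x) f (phi x).
Proof.
move=> dphi df; have dp := differentiable_rV dphi.
rewrite deriveE; last exact: differentiable_comp.
by rewrite diff_comp //= -deriveE // -deriveE.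
Qed.

(** By the chain rule the composites k o phi, with k smooth on E, together
    with the smooth functions on D, generate an algebra stable under
    derivation. *)
Lemma smooth_on_comp D E (phi : 'rV[R]_m -> 'rV[R]_m) f : open D ->
  (forall x, D x -> E (phi x)) ->
  (forall j, smooth_on D (fun x => phi x ord0 j)) ->
  smooth_on E f -> smooth_on D (f \o phi).
Proof.
move=> oD DE sphi sf.
pose B h := smooth_on D h \/ exists2 k, smooth_on E k & h = k \o phi.
have dphi x j : D x -> differentiable (fun y => phi y ord0 j) x.
  by move=> Dx; exact: smooth_on_diff (sphi j) Dx.
apply: (@smooth_on_gen D B) => //; last by apply: gen_base; right; exists f.
- move=> b x [sh|[k sk ->]] Dx; first exact: smooth_on_diff sh Dx.
  apply: differentiable_comp; first by apply: differentiable_rV => j; exact: dphi.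
  by apply: smooth_on_diff sk _; exact: DE.
- move=> b v [sh|[k sk ->]]; first by apply: gen_base; left; exact: smooth_on_derive.
  apply: (@gen_eq _ _ (fun x => \sum_j ('D_(delta_mx ord0 j) k \o phi) x *
      'D_v (fun y => phi y ord0 j) x)).
    move=> x Dx; rewrite derive_comp_partials //; first by move=> j; exact: dphi.
    by apply: smooth_on_diff sk _; exact: DE.
  apply: gen_alg_sum => j; apply: gen_mul; apply: gen_base.
    by right; exists ('D_(delta_mx ord0 j) k) => //; exact: smooth_on_derive.
  by left; exact: smooth_on_derive.
Qed.

(** Differentiating G^2 F = 1, where G = F^(-1/2), expresses dG as a
    polynomial in G and dF. *)
Lemma rsqrt_derivative (G F dF dG : R) : G * G * F = 1 ->
  (G * G) * dF + F * (G * dG + G * dG) = 0 ->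
  - 2^-1 * (G * (G * G) * dF) = dG.
Proof.
move=> GGF E.
have : G * ((G * G) * dF + F * (G * dG + G * dG)) = 0 by rewrite E mulr0.
have -> : G * (G * G * dF + F * (G * dG + G * dG))
  = G * (G * G) * dF + 2 * ((G * G * F) * dG) by ring.
by rewrite GGF => H; lra.
Qed.

(** If g = f^(-1/2), then dg = - g^3 df / 2, so that g and the smooth
    functions generate an algebra stable under derivation. *)
Lemma smooth_on_rsqrt D f : open D -> (forall x, D x -> 0 < f x) ->
  smooth_on D f -> smooth_on D (fun x => (Num.sqrt (f x))^-1).
Proof.
move=> oD f0 sf; set g : 'rV[R]_m -> R := fun x => _.
have dg x : D x -> differentiable g x.
  move=> Dx; apply: differentiableV; last by rewrite gt_eqF // sqrtr_gt0 f0.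
  apply: (@differentiable_comp _ _ _ _ f (@Num.sqrt R)).
    exact: smooth_on_diff sf Dx.
  by apply/derivable1_diffP; have [] := is_derive1_sqrt (f0 x Dx).
have gg x : D x -> g x * g x * f x = 1.
  move=> Dx; rewrite /g -invfM -expr2 sqr_sqrtr ?ltW ?f0 //.
  by rewrite mulVf // gt_eqF // f0.
pose B h := smooth_on D h \/ h = g.
apply: (@smooth_on_gen D B) => //; last by apply: gen_base; right.
- by move=> b x [sh|->] Dx; [exact: smooth_on_diff sh Dx|exact: dg].
- move=> b v [sh|->]; first by apply: gen_base; left; exact: smooth_on_derive.
  apply: (@gen_eq _ _ (fun x => (- 2^-1) * ((g x * (g x * g x)) * 'D_v f x))).
    move=> x Dx.
    have E : (g x * g x) * 'D_v f x + f x * (g x * 'D_v g x + g x * 'D_v g x) = 0.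
      have dgx := dg x Dx; have dfx := smooth_on_diff sf Dx.
      rewrite -(deriveM_at v dgx dgx) -deriveM_at //; last exact: differentiableM.
      rewrite -(derive_cst (1 : R) x v); apply: derive_near_on oD Dx _.
      exact: gg.
    exact: rsqrt_derivative (gg x Dx) E.
  apply: gen_mul; first exact: gen_cst.
  have Gg : gen_alg D B g by apply: gen_base; right.
  apply: gen_mul; first by do 2?apply: gen_mul.
  by apply: gen_base; left; exact: smooth_on_derive.
Qed.

End SmoothOn.

(** * Smooth functions, tangent vectors and vector fields on a manifold *)

Section Manifolds.
Context {R : realType} {m : nat} (M : manifold R m).
Implicit Types (c : chart R m M) (U V W : set M) (f g : M -> R) (p q : M).
Implicit Types (u v : tvec M) (X Y Z : vfield M).

Lemma chart_image_open c U : open U -> open (cmap c @` (cdom c `&` U)).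
Proof.
move=> oU; rewrite openE => _ [q [cq Uq] <-].
have : \forall x \near cmap c q, U (cinv c x).
  by apply: (cinv_continuous cq); rewrite (cmapK cq); exact: open_nbhs_nbhs.
have : \forall x \near cmap c q, (cmap c @` cdom c) x.
  by apply: open_nbhs_nbhs; split; [exact: cimg_open|exists q].
apply: filterS2 => x [y cy <-]; rewrite (cmapK cy) => Uy.
by exists y.
Qed.

(** The points near the image of p are the coordinates of points of U, which
    turns a statement about germs in the chart into one about points of M. *)
Lemma near_chart c U p : open U -> cdom c p -> U p ->
  \forall x \near cmap c p, exists2 q, cdom c q /\ U q & x = cmap c q.
Proof.
move=> oU cp Up; apply: open_near (chart_image_open (c := c) oU) _ _; first by exists p.
by move=> _ [q cUq <-]; exists q.
Qed.

Lemma smooth_subset U V f : U `<=` V -> smooth V f -> smooth U f.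
Proof.
move=> UV sf c ac; apply: smooth_on_sub (sf c ac).
by apply: image_subset; exact: setIS.
Qed.

Lemma smooth_ext U f g : open U -> (forall p, U p -> f p = g p) ->
  smooth U f -> smooth U g.
Proof.
move=> oU fg sf c ac; apply: smooth_on_eq (sf c ac); first exact: chart_image_open.
by move=> _ [q [cq Uq] <-]; rewrite /= (cmapK cq) fg.
Qed.

Lemma smooth_cst U (k : R) : open U -> smooth U (fun=> k).
Proof. by move=> oU c ac; apply: smooth_on_cst; exact: chart_image_open. Qed.

Lemma smoothD U f g : open U -> smooth U f -> smooth U g ->
  smooth U (fun p => f p + g p).
Proof.
by move=> oU sf sg c ac; apply: smooth_onD (sf c ac) (sg c ac); exact: chart_image_open.
Qed.

Lemma smoothM U f g : open U -> smooth U f -> smooth U g ->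
  smooth U (fun p => f p * g p).
Proof.
by move=> oU sf sg c ac; apply: smooth_onM (sf c ac) (sg c ac); exact: chart_image_open.
Qed.

Lemma smoothN U f : open U -> smooth U f -> smooth U (fun p => - f p).
Proof.
move=> oU sf; apply: (@smooth_ext _ (fun p => (-1) * f p)) => //.
  by move=> p _; rewrite mulN1r.
by apply: smoothM => //; exact: smooth_cst.
Qed.

Lemma smooth_rsqrt U f : open U -> (forall p, U p -> 0 < f p) -> smooth U f ->
  smooth U (fun p => (Num.sqrt (f p))^-1).
Proof.
move=> oU f0 sf c ac; apply: smooth_on_rsqrt (sf c ac).
  exact: chart_image_open.
by move=> _ [q [cq Uq] <-]; rewrite /= (cmapK cq) f0.
Qed.

Lemma smooth_continuous U f p : open U -> U p -> smooth U f ->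
  {for p, continuous f}.
Proof.
move=> oU Up sf; have [c ac cp] := atlas_cover p.
have dfc : differentiable (f \o cinv c) (cmap c p).
  by apply: (smooth_on_diff (sf c ac)); exists p.
have cfc := differentiable_continuous dfc.
have fcont : (f \o cinv c) \o cmap c @ p --> f (cinv c (cmap c p)).
  by apply: continuous_comp => //; exact: cmap_continuous.
rewrite (cmapK cp) in fcont.
apply: cvg_trans fcont; apply: near_eq_cvg.
apply: open_near (@cdom_open _ _ _ c) cp _ => q cq /=.
by rewrite (cmapK cq).
Qed.

Lemma smooth_at_in U f p : open U -> U p -> smooth U f -> smooth_at p f.
Proof. by move=> oU Up sf; exists U. Qed.

Lemma smooth_at_differentiable c f p : atlas c -> cdom c p -> smooth_at p f ->
  differentiable (f \o cinv c) (cmap c p).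
Proof. by move=> ac cp [U [oU Up /(_ _ ac) sf]]; apply: (smooth_on_diff sf); exists p. Qed.

(** The tangent vector with components w in the chart c. *)
Definition chart_vec c p (w : 'rV[R]_m) : tvec M := fun f =>
  if `[< smooth_at p f >] then 'D_w (f \o cinv c) (cmap c p) else 0.

Lemma chart_vecE c p w f : smooth_at p f ->
  chart_vec c p w f = 'D_w (f \o cinv c) (cmap c p).
Proof. by move=> sf; rewrite /chart_vec asboolT. Qed.

Lemma tangent_chart_vec c p w : atlas c -> cdom c p -> tangent p (chart_vec c p w).
Proof. by move=> ac cp; exists c, w. Qed.

(** Every chart around p sees every tangent vector at p: the components change
    by the derivative of the transition map. *)
Lemma tangent_in_chart c p v : atlas c -> cdom c p -> tangent p v ->
  exists w, v = chart_vec c p w.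
Proof.
move=> ac cp [c' [w [ac' cp' vE]]].
pose tr := cmap c \o cinv c'.
have dtr j : differentiable (fun y => tr y ord0 j) (cmap c' p).
  by apply: (smooth_on_diff (atlas_compatible ac' ac j)); exists p.
exists ('D_w tr (cmap c' p)); apply/funext => f; rewrite vE /chart_vec.
case: asboolP => // sf.
have trp : tr (cmap c' p) = cmap c p by rewrite /tr /= (cmapK cp').
have dfc : differentiable (f \o cinv c) (tr (cmap c' p)).
  by rewrite trp; exact: smooth_at_differentiable.
rewrite -trp -(derive_comp _ dtr dfc).
apply: near_eq_derive.
have := near_chart (@cdom_open _ _ _ c) cp' cp; apply: filterS => x [q [cq' cq] ->].
by rewrite /tr /= (cmapK cq') (cmapK cq).
Qed.

Lemma tvec_linE (a : R) u v f : (a *: u + v) f = a * u f + v f.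
Proof. by []. Qed.

Lemma chart_vec_linear c p (a : R) w w' : atlas c -> cdom c p ->
  chart_vec c p (a *: w + w') = a *: chart_vec c p w + chart_vec c p w'.
Proof.
move=> ac cp; apply/funext => f.
have [sf|nsf] := pselect (smooth_at p f); last first.
  by rewrite tvec_linE /chart_vec asboolF // mulr0 addr0.
have df := smooth_at_differentiable ac cp sf.
rewrite tvec_linE !chart_vecE // !deriveE //.
exact: linearP.
Qed.

Lemma chart_vec0 c p : chart_vec c p 0 = 0.
Proof. by apply/funext => f; rewrite /chart_vec; case: asboolP; rewrite ?derive0. Qed.

Lemma chart_vec_sum c p n (k : 'I_n -> R) (w : 'I_n -> 'rV[R]_m) :
  atlas c -> cdom c p ->
  chart_vec c p (\sum_i k i *: w i) = \sum_i k i *: chart_vec c p (w i).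
Proof.
move=> ac cp; elim/big_rec2: _ => [|i u v _ <-]; first exact: chart_vec0.
by rewrite chart_vec_linear.
Qed.

(** The components of a vector are its values on the coordinate functions,
    which are smooth because the charts are compatible. *)
Lemma chart_vec_inj c p w : atlas c -> cdom c p -> chart_vec c p w = 0 -> w = 0.
Proof.
move=> ac cp w0; apply/rowP => j; rewrite mxE.
pose f q := cmap c q ord0 j.
have sf : smooth_at p f.
  exists (cdom c); split => //; first exact: cdom_open.
  by move=> c' ac'; exact: atlas_compatible.
have : chart_vec c p w f = 0 by rewrite w0.
rewrite chart_vecE // => <-.
have -> : 'D_w (f \o cinv c) (cmap c p) = 'D_w (fun x : 'rV[R]_m => x ord0 j) (cmap c p).
  apply: near_eq_derive.
  have := near_chart (@openT M) cp I; apply: filterS => x [q [cq _] ->].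
  by rewrite /f /= (cmapK cq).
have := derive_mx (@derivable_id R 'rV[R]_m (cmap c p) w).
by rewrite derive_id => /matrixP/(_ ord0 j); rewrite mxE.
Qed.

Lemma tangent_lin p (a : R) u v : tangent p u -> tangent p v ->
  tangent p (a *: u + v).
Proof.
move=> tu tv; have [c ac cp] := atlas_cover p.
have [w ->] := tangent_in_chart ac cp tu.
have [w' ->] := tangent_in_chart ac cp tv.
by rewrite -chart_vec_linear //; exact: tangent_chart_vec.
Qed.

Lemma tangent0 p : tangent p (0 : tvec M).
Proof.
have [c ac cp] := atlas_cover p.
by rewrite -(chart_vec0 c p); exact: tangent_chart_vec.
Qed.

Lemma tangentZ p (a : R) u : tangent p u -> tangent p (a *: u).
Proof. by move=> tu; rewrite -[_ *: _]addr0; apply: tangent_lin => //; exact: tangent0. Qed.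

Lemma tangentD p u v : tangent p u -> tangent p v -> tangent p (u + v).
Proof. by move=> tu tv; rewrite -[u]scale1r; exact: tangent_lin. Qed.

Lemma tangentN p u : tangent p u -> tangent p (- u).
Proof. by move=> tu; rewrite -scaleN1r; exact: tangentZ. Qed.

Lemma tangentB p u v : tangent p u -> tangent p v -> tangent p (u - v).
Proof. by move=> tu tv; apply: tangentD => //; exact: tangentN. Qed.

Lemma tangent_eq U p v f g : tangent p v -> open U -> U p ->
  (forall q, U q -> f q = g q) -> smooth U f -> v f = v g.
Proof.
move=> tv oU Up fg sf; have [c ac cp] := atlas_cover p.
have [w ->] := tangent_in_chart ac cp tv.
have sg := smooth_ext oU fg sf.
rewrite !chart_vecE; [|exact: smooth_at_in sg|exact: smooth_at_in sf].
apply: near_eq_derive.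
have := near_chart oU cp Up; apply: filterS => x [q [cq Uq] ->].
by rewrite /= (cmapK cq) fg.
Qed.

Lemma tangent_cst p v (k : R) : tangent p v -> v (fun=> k) = 0.
Proof.
move=> tv; have [c ac cp] := atlas_cover p.
have [w ->] := tangent_in_chart ac cp tv.
rewrite chart_vecE; first exact: derive_cst.
exact: smooth_at_in openT I (smooth_cst _ openT).
Qed.

Lemma tangent_add U p v f g : tangent p v -> open U -> U p ->
  smooth U f -> smooth U g -> v (fun q => f q + g q) = v f + v g.
Proof.
move=> tv oU Up sf sg; have [c ac cp] := atlas_cover p.
have [w ->] := tangent_in_chart ac cp tv.
have saf := smooth_at_in oU Up sf; have sag := smooth_at_in oU Up sg.
have sas := smooth_at_in oU Up (smoothD oU sf sg).
rewrite !chart_vecE //.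
by rewrite (@deriveD _ _ _ (f \o cinv c) (g \o cinv c)) //;
  apply: diff_derivable; exact: smooth_at_differentiable.
Qed.

Lemma tangent_mul U p v f g : tangent p v -> open U -> U p ->
  smooth U f -> smooth U g ->
  v (fun q => f q * g q) = f p * v g + g p * v f.
Proof.
move=> tv oU Up sf sg; have [c ac cp] := atlas_cover p.
have [w ->] := tangent_in_chart ac cp tv.
have saf := smooth_at_in oU Up sf; have sag := smooth_at_in oU Up sg.
have sas := smooth_at_in oU Up (smoothM oU sf sg).
rewrite !chart_vecE //.
rewrite -[in f p](cmapK cp) -[in g p](cmapK cp).
by rewrite -(@deriveM_at _ _ (f \o cinv c) (g \o cinv c)) //;
  exact: smooth_at_differentiable.
Qed.

Lemma tangent_opp U p v f : tangent p v -> open U -> U p ->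
  smooth U f -> v (fun q => - f q) = - v f.
Proof.
move=> tv oU Up sf; apply/eqP; rewrite -addr_eq0; apply/eqP.
rewrite -(tangent_add tv oU Up (smoothN oU sf) sf) -(tangent_cst 0 tv).
apply: (tangent_eq tv oU Up); first by move=> q _; rewrite addNr.
exact: smoothD (smoothN oU sf) sf.
Qed.

Lemma vfield_on_sub U V X : V `<=` U -> vfield_on U X -> vfield_on V X.
Proof.
move=> VU [tX sX]; split=> [p /VU|W f oW WV]; first exact: tX.
by apply: sX => // p /WV /VU.
Qed.

Lemma vfield_on_ext U X Y : (forall p, U p -> X p = Y p) ->
  vfield_on U X -> vfield_on U Y.
Proof.
move=> XY [tX sX]; split=> [p Up|W f oW WU sf]; first by rewrite -XY //; exact: tX.
apply: smooth_ext (sX W f oW WU sf) => // p /WU Up.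
by rewrite /dir XY.
Qed.

Lemma vfield_on_lin U f X Y : open U -> smooth U f -> vfield_on U X ->
  vfield_on U Y -> vfield_on U (fun q => f q *: X q + Y q).
Proof.
move=> oU sf [tX sX] [tY sY]; split=> [p Up|W g oW WU sg].
  by apply: tangent_lin; [exact: tX|exact: tY].
apply: (@smooth_ext _ (fun p => f p * dir X g p + dir Y g p)) => //.
apply: smoothD; [by []| |exact: sY].
by apply: smoothM; [by []|exact: smooth_subset sf|exact: sX].
Qed.

Lemma vfield_on0 U : vfield_on U (fun=> 0).
Proof.
split=> [p _|W f oW _ _]; first exact: tangent0.
exact: smooth_cst.
Qed.

Lemma vfield_onB U X Y : open U -> vfield_on U X -> vfield_on U Y ->
  vfield_on U (fun q => X q - Y q).
Proof.
move=> oU vX vY.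
apply: (@vfield_on_ext _ (fun q => (-1) *: Y q + X q)).
  by move=> p _; rewrite scaleN1r addrC.
by apply: vfield_on_lin => //; exact: smooth_cst.
Qed.

Definition chart_field c w : vfield M := fun p => chart_vec c p w.

(** In another chart c' the derivative of f along the field is the derivative
    of f in the chart c composed with the transition map, hence smooth. *)
Lemma chart_field_on c w : atlas c -> vfield_on (cdom c) (chart_field c w).
Proof.
move=> ac; split=> [p cp|W f oW Wc sf]; first exact: tangent_chart_vec.
move=> c' ac'; pose D := cmap c' @` (cdom c' `&` W).
have oD : open D by exact: chart_image_open.
pose tr := cmap c \o cinv c'.
apply: (@smooth_on_eq _ _ _ ('D_w (f \o cinv c) \o tr)) => //.
  move=> _ [q [cq' Wq] <-] /=; rewrite /dir /chart_field chart_vecE.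
    by rewrite /tr /= (cmapK cq').
  by rewrite (cmapK cq'); exact: smooth_at_in sf.
apply: (@smooth_on_comp _ _ _ (cmap c @` (cdom c `&` W))) => //.
- move=> _ [q [cq' Wq] <-]; rewrite /tr /= (cmapK cq').
  by exists q => //; split => //; exact: Wc.
- move=> j; apply: smooth_on_sub (atlas_compatible ac' ac j).
  by apply: image_subset => q [cq' Wq]; split => //; exact: Wc.
- by apply: smooth_on_derive; exact: sf.
Qed.

End Manifolds.

(** * Orthonormal families in the tangent spaces *)

Section Metric.
Context {R : realType} {m : nat} (M : manifold R m) (g : form2 M)
  (hg : riemannian_metric g).
Implicit Types (U : set M) (p : M) (u v w : tvec M) (X Y Z : vfield M).

Lemma inner_sym p u v : tangent p u -> tangent p v -> g p u v = g p v u.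
Proof. by case: hg => H _ _ _; exact: H. Qed.

Lemma inner_linl p a u v w : tangent p u -> tangent p v -> tangent p w ->
  g p (a *: u + v) w = a * g p u w + g p v w.
Proof. by case: hg => _ H _ _; exact: H. Qed.

Lemma inner_smooth U X Y : open U -> vfield_on U X -> vfield_on U Y ->
  smooth U (f2app g X Y).
Proof. by case: hg => _ _ _; exact. Qed.

Lemma inner0l p w : tangent p w -> g p 0 w = 0.
Proof.
move=> tw; have t0 := tangent0 p.
have := inner_linl 1 t0 t0 tw; rewrite scaler0 add0r => E; lra.
Qed.

Lemma innerZl p a u w : tangent p u -> tangent p w ->
  g p (a *: u) w = a * g p u w.
Proof.
move=> tu tw; rewrite -[a *: u]addr0 inner_linl ?inner0l ?addr0 //.
exact: tangent0.
Qed.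

Lemma innerDl p u v w : tangent p u -> tangent p v -> tangent p w ->
  g p (u + v) w = g p u w + g p v w.
Proof. by move=> tu tv tw; rewrite -[u]scale1r inner_linl // mul1r scale1r. Qed.

Lemma innerNl p u w : tangent p u -> tangent p w -> g p (- u) w = - g p u w.
Proof. by move=> tu tw; rewrite -scaleN1r innerZl // mulN1r. Qed.

Lemma innerBl p u v w : tangent p u -> tangent p v -> tangent p w ->
  g p (u - v) w = g p u w - g p v w.
Proof.
move=> tu tv tw; rewrite innerDl ?innerNl //; exact: tangentN.
Qed.

Lemma inner_suml p n (k : 'I_n -> R) (u : 'I_n -> tvec M) w :
  (forall i, tangent p (u i)) -> tangent p w ->
  g p (\sum_i k i *: u i) w = \sum_i k i * g p (u i) w.
Proof.
move=> tu tw.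
suff [] : tangent p (\sum_i k i *: u i) /\
  g p (\sum_i k i *: u i) w = \sum_i k i * g p (u i) w by [].
elim/big_rec2: _ => [|i x y _ [ty <-]].
  by split; [exact: tangent0|exact: inner0l].
by split; [exact: tangent_lin|rewrite inner_linl].
Qed.

(** The m component vectors of an orthonormal family are linearly independent,
    since g reads off the coefficients of a linear combination; so they form
    an invertible matrix and span. *)
Lemma orthonormal_expansion p (E : 'I_m -> tvec M) v :
  orthonormal_at g p E -> tangent p v -> v = \sum_i g p v (E i) *: E i.
Proof.
move=> [tE gE] tv; have [c ac cp] := atlas_cover p.
have [w vE] := tangent_in_chart ac cp tv.
have /choice[W EW] i : exists x, E i = chart_vec c p x := tangent_in_chart ac cp (tE i).
pose A : 'M[R]_m := \matrix_i W i.
have AE (k : 'rV[R]_m) : chart_vec c p (k *m A) = \sum_i k ord0 i *: E i.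
  rewrite mulmx_sum_row chart_vec_sum //; apply: eq_bigr => i _.
  by rewrite rowK -EW.
have coef (k : 'I_m -> R) j : g p (\sum_i k i *: E i) (E j) = k j.
  rewrite inner_suml // (bigD1 j) //= gE eqxx mulr1 big1 ?addr0 // => i ij.
  by rewrite gE (negbTE ij) mulr0.
have A_unit : A \in unitmx.
  rewrite -row_free_unit -kermx_eq0; apply/rowV0P => k /sub_kermxP kA.
  apply/rowP => j; rewrite mxE.
  by rewrite -(coef (k ord0)) -AE kA chart_vec0 inner0l.
have vA : v = \sum_i (w *m invmx A) ord0 i *: E i by rewrite -AE mulmxKV.
by rewrite {1}vA; apply: eq_bigr => i _; rewrite vA coef.
Qed.

Lemma inner_parseval p (E : 'I_m -> tvec M) u v :
  orthonormal_at g p E -> tangent p u -> tangent p v ->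
  g p u v = \sum_i g p u (E i) * g p v (E i).
Proof.
move=> oE tu tv; have tE := oE.1.
rewrite {1}(orthonormal_expansion oE tu) inner_suml //.
by apply: eq_bigr => i _; rewrite (inner_sym tv).
Qed.

End Metric.

(** * The Levi-Civita connection in an orthonormal frame *)

Section LeviCivita.
Context {R : realType} {m : nat} (M : manifold R m) (g : form2 M)
  (nabla : vfield M -> vfield M -> vfield M)
  (hg : riemannian_metric g) (hn : levi_civita g nabla).
Implicit Types (U : set M) (p : M) (X Y Z : vfield M) (f : M -> R).

Lemma nabla_on U X Y : open U -> vfield_on U X -> vfield_on U Y ->
  vfield_on U (nabla X Y).
Proof. by case: (hn) => [[H _ _ _] _ _]; exact: H. Qed.

Lemma torsion_free U X Y p : open U -> vfield_on U X -> vfield_on U Y -> U p ->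
  bracket X Y p = nabla X Y p - nabla Y X p.
Proof. by move=> oU vX vY Up; case: (hn) => _ /(_ _ _ _ oU vX vY p Up) ->. Qed.

Lemma inner_compat U X Y Z p : open U ->
  vfield_on U X -> vfield_on U Y -> vfield_on U Z -> U p ->
  dir X (f2app g Y Z) p = f2app g (nabla X Y) Z p + f2app g Y (nabla X Z) p.
Proof. by move=> oU vX vY vZ Up; case: (hn) => _ _ H; exact: (H U). Qed.

(** That the bracket of two fields is again tangent would require the symmetry
    of second derivatives; here the torsion-free connection provides it at
    once. *)
Lemma bracket_on U X Y : open U -> vfield_on U X -> vfield_on U Y ->
  vfield_on U (bracket X Y).
Proof.
move=> oU vX vY; apply: vfield_on_ext (vfield_onB oU (nabla_on oU vX vY)
  (nabla_on oU vY vX)) => p Up.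
by rewrite (torsion_free oU vX vY Up).
Qed.

Lemma nabla0l U Y p : open U -> vfield_on U Y -> U p -> nabla (fun=> 0) Y p = 0.
Proof.
move=> oU vY Up; case: (hn) => [[_ loc linl _] _ _].
have v0 := vfield_on0 U.
have := linl U (fun=> 1) _ _ Y oU (smooth_cst _ oU) v0 v0 vY p Up.
rewrite (loc U _ (fun=> 0) Y Y oU _ v0 vY vY _ _ p Up) //; first last.
- by move=> q _; rewrite scaler0 addr0.
- by apply: vfield_on_lin => //; exact: smooth_cst.
by rewrite scale1r => /eqP; rewrite -subr_eq0 opprD addNKr oppr_eq0 => /eqP.
Qed.

(** Tensoriality in the first argument; the two conclusions are proved
    together because the induction needs partial sums to be vector fields. *)
Lemma nabla_suml U n (k : 'I_n -> M -> R) (X : 'I_n -> vfield M) Y p : open U ->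
  (forall i, smooth U (k i)) -> (forall i, vfield_on U (X i)) ->
  vfield_on U Y -> U p ->
  vfield_on U (fun q => \sum_i k i q *: X i q) /\
  nabla (fun q => \sum_i k i q *: X i q) Y p = \sum_i k i p *: nabla (X i) Y p.
Proof.
move=> oU + + vY Up; case: (hn) => [[_ loc linl _] _ _].
elim: n k X => [|n IHn] k X sk vX.
  have v0 := vfield_on0 U.
  have v0' : vfield_on U (fun q : M => \sum_(i < 0) k i q *: X i q).
    by apply: vfield_on_ext v0 => q _; rewrite big_ord0.
  split=> //; rewrite big_ord0; apply: etrans (nabla0l oU vY Up).
  by apply: (loc U) => // q _; rewrite big_ord0.
pose X' q := \sum_(i < n) k (lift ord0 i) q *: X (lift ord0 i) q.
have [vX' nX'] := IHn (fun i => k (lift ord0 i)) (fun i => X (lift ord0 i))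
  (fun i => sk _) (fun i => vX _).
have vS := vfield_on_lin oU (sk ord0) (vX ord0) vX'.
have ES q : k ord0 q *: X ord0 q + X' q = \sum_i k i q *: X i q.
  by rewrite big_ord_recl.
have vS' : vfield_on U (fun q => \sum_i k i q *: X i q).
  by apply: vfield_on_ext vS => q _; exact: ES.
split=> //; rewrite big_ord_recl -nX'.
rewrite -(linl U (k ord0) (X ord0) X' Y) //.
by apply: (loc U) => // q _; rewrite ES.
Qed.

Section Frame.
Context (U : set M) (E : 'I_m -> vfield M) (oU : open U)
  (hE : orthonormal_frame g U E).

Lemma frame_on i : vfield_on U (E i).
Proof. by case: hE. Qed.

Lemma frame_orthonormal p : U p -> orthonormal_at g p (fun i => E i p).
Proof. by case: hE => _; exact. Qed.

Lemma vfield_tangent X p : vfield_on U X -> U p -> tangent p (X p).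
Proof. by case=> tX _; exact: tX. Qed.

Lemma nabla_frame X Y p : vfield_on U X -> vfield_on U Y -> U p ->
  nabla X Y p = \sum_i f2app g X (E i) p *: nabla (E i) Y p.
Proof.
move=> vX vY Up.
have sk i : smooth U (f2app g X (E i)).
  by apply: inner_smooth => //; exact: frame_on.
have [vS <-] := nabla_suml oU sk frame_on vY Up.
case: (hn) => [[_ loc _ _] _ _]; apply: (loc U) => // q Uq.
exact: orthonormal_expansion (frame_orthonormal Uq) (vfield_tangent vX Uq).
Qed.

(** The frame being orthonormal, these are the coefficients of nabla_Ei Ej in
    the frame. *)
Definition christoffel i j k : M -> R := f2app g (nabla (E i) (E j)) (E k).
Local Notation Gam := christoffel.

Lemma nabla_frame_on i j : vfield_on U (nabla (E i) (E j)).
Proof. by apply: nabla_on => //; exact: frame_on. Qed.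

Lemma christoffel_smooth i j k : smooth U (Gam i j k).
Proof. by apply: inner_smooth => //; [exact: nabla_frame_on|exact: frame_on]. Qed.

Lemma christoffel_skew i j k p : U p -> Gam i j k p = - Gam i k j p.
Proof.
move=> Up; apply/eqP; rewrite -addr_eq0; apply/eqP.
have tE l : tangent p (E l p) := vfield_tangent (frame_on l) Up.
rewrite /Gam [X in _ + X]/f2app (inner_sym hg) //; last first.
  exact: vfield_tangent (nabla_frame_on _ _) Up.
have := inner_compat oU (frame_on i) (frame_on j) (frame_on k) Up.
rewrite /f2app => <-.
rewrite -(tangent_cst (j == k)%:R (tE i)) /dir.
apply: tangent_eq (tE i) oU Up _ _ => [q Uq|].
  by have [_ ->] := frame_orthonormal Uq.
exact: inner_smooth (frame_on j) (frame_on k).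
Qed.

(** Metric compatibility moves the derivative of X onto the frame, so the
    components of nabla_Ei X are found without the Leibniz rule of the
    connection. *)
Lemma nabla_coord X i j p : vfield_on U X -> U p ->
  g p (nabla (E i) X p) (E j p)
  = dir (E i) (f2app g X (E j)) p - \sum_l f2app g X (E l) p * Gam i j l p.
Proof.
move=> vX Up; rewrite (inner_compat oU (frame_on i) vX (frame_on j) Up).
rewrite [X in _ + X - _](inner_parseval hg (frame_orthonormal Up)).
- by rewrite /f2app addrK.
- exact: vfield_tangent vX Up.
- exact: vfield_tangent (nabla_frame_on _ _) Up.
Qed.

Lemma bracket_coord i j k p : U p ->
  f2app g (bracket (E i) (E j)) (E k) p = Gam i j k p - Gam j i k p.
Proof.
move=> Up; rewrite /f2app (torsion_free oU (frame_on i) (frame_on j) Up).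
by rewrite (innerBl hg) //; apply: vfield_tangent => //;
  first [exact: nabla_frame_on|exact: frame_on].
Qed.

(** The bracket is [Ei, Ej] = nabla_Ei Ej - nabla_Ej Ei, evaluated on f. *)
Lemma frame_commutator i j f p : smooth U f -> U p ->
  dir (E i) (dir (E j) f) p - dir (E j) (dir (E i) f) p
  = \sum_k (Gam i j k p - Gam j i k p) * dir (E k) f p.
Proof.
move=> sf Up.
have -> : dir (E i) (dir (E j) f) p - dir (E j) (dir (E i) f) p
    = bracket (E i) (E j) p f.
  by rewrite /bracket asboolT //; exact: smooth_at_in sf.
rewrite (orthonormal_expansion hg (frame_orthonormal Up)
  (vfield_tangent (bracket_on oU (frame_on i) (frame_on j)) Up)).
rewrite fct_sumE; apply: eq_bigr => k _.
by rewrite -bracket_coord.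
Qed.

Lemma curvature_coord i j k l p : U p ->
  f2app g (curvature nabla (E i) (E j) (E k)) (E l) p
  = (dir (E i) (Gam j k l) p - \sum_n Gam j k n p * Gam i l n p)
    - (dir (E j) (Gam i k l) p - \sum_n Gam i k n p * Gam j l n p)
    - \sum_n (Gam i j n p - Gam j i n p) * Gam n k l p.
Proof.
move=> Up.
have tan X : vfield_on U X -> tangent p (X p) by move=> vX; exact: vfield_tangent Up.
have vE := frame_on; have vN := nabla_frame_on.
have vB := bracket_on oU (vE i) (vE j).
have tE n : tangent p (E n p) := tan _ (vE n).
have tNN a b c : tangent p (nabla (E a) (nabla (E b) (E c)) p).
  by apply: tan; apply: nabla_on.
have tNB : tangent p (nabla (bracket (E i) (E j)) (E k) p).
  by apply: tan; exact: nabla_on.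
rewrite /f2app /curvature !(innerBl hg) //; last exact: tangentB.
rewrite !nabla_coord //; congr (_ - _).
rewrite nabla_frame // (inner_suml hg) //; last by move=> n; apply: tan.
by apply: eq_bigr => n _; rewrite bracket_coord.
Qed.

End Frame.
End LeviCivita.

(** * Algebra of almost contact metric structures *)

Section AlmostContact.
Context {R : realType} {m : nat} (M : manifold R m) (phi : tensor11 M)
  (xi : vfield M) (eta : form1 M) (g : form2 M)
  (hc : almost_contact_metric phi xi eta g).
Implicit Types (U : set M) (p : M) (u v : tvec M) (X Y Z : vfield M).

Lemma contact_metric : riemannian_metric g.
Proof. by case: hc => -[]. Qed.

Lemma phi_on U X : open U -> vfield_on U X -> vfield_on U (tapp phi X).
Proof. by case: hc => -[[_ _ H] _ _ _] _; exact: H. Qed.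

Lemma phi_tangent p u : tangent p u -> tangent p (phi p u).
Proof. by case: hc => -[[H _ _] _ _ _] _; exact: H. Qed.

Lemma phi_lin p a u v : tangent p u -> tangent p v ->
  phi p (a *: u + v) = a *: phi p u + phi p v.
Proof. by case: hc => -[[_ H _] _ _ _] _; exact: H. Qed.

Lemma eta_lin p a u v : tangent p u -> tangent p v ->
  eta p (a *: u + v) = a * eta p u + eta p v.
Proof. by case: hc => -[_ _ [H _] _] _; exact: H. Qed.

Lemma eta_smooth U X : open U -> vfield_on U X -> smooth U (f1app eta X).
Proof. by case: hc => -[_ _ [_ H] _] _; exact: H. Qed.

Lemma xi_on U : vfield_on U xi.
Proof. by case: hc => -[_ H _ _] _; exact: vfield_on_sub H. Qed.

Lemma xi_tangent p : tangent p (xi p).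
Proof. by have [H _] := xi_on setT; exact: H. Qed.

Lemma phi_phi p u : tangent p u -> phi p (phi p u) = - u + eta p u *: xi p.
Proof. by case: hc => _ [H _ _]; exact: H. Qed.

Lemma eta_xi p : eta p (xi p) = 1.
Proof. by case: hc => _ []. Qed.

Lemma inner_phi p u v : tangent p u -> tangent p v ->
  g p (phi p u) (phi p v) = g p u v - eta p u * eta p v.
Proof. by case: hc => _ [_ _ H]; exact: H. Qed.

Let hg := contact_metric.

Lemma phi0 p : phi p 0 = 0.
Proof.
have t0 := tangent0 p; have := phi_lin 1 t0 t0.
by rewrite !scale1r addr0 => /eqP; rewrite -subr_eq0 opprD addNKr oppr_eq0 => /eqP.
Qed.

Lemma phi_scale p a u : tangent p u -> phi p (a *: u) = a *: phi p u.
Proof.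
by move=> tu; rewrite -[a *: u]addr0 phi_lin ?phi0 ?addr0 //; exact: tangent0.
Qed.

(** The vector z = phi xi satisfies phi z = phi^2 xi = 0. Then phi^2 z = 0
    says z = c xi with c = eta(z), so 0 = phi z = c z, and either factor being
    zero gives z = 0. *)
Lemma phi_xi p : phi p (xi p) = 0.
Proof.
have tx := xi_tangent p; have tz := phi_tangent tx.
set z := phi p (xi p).
have z1 : phi p z = 0 by rewrite /z phi_phi // eta_xi scale1r addNr.
have z2 : z = eta p z *: xi p.
  have := phi_phi tz; rewrite -/z z1 phi0 => /eqP.
  by rewrite eq_sym addrC subr_eq0 => /eqP.
have : eta p z *: z = 0.
  by rewrite -[RHS]z1 [in RHS]z2 phi_scale.
by move=> /eqP; rewrite scaler_eq0 => /orP[/eqP e0|/eqP//]; rewrite z2 e0 scale0r.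
Qed.

(** This is the compatibility of g and phi with second argument xi, because
    phi xi = 0. *)
Lemma inner_xi p u : tangent p u -> g p u (xi p) = eta p u.
Proof.
move=> tu; have tx := xi_tangent p.
have := inner_phi tu tx.
rewrite phi_xi eta_xi mulr1 (inner_sym hg) ?(inner0l hg).
- by move/esym/eqP; rewrite subr_eq0 => /eqP.
- exact: phi_tangent.
- exact: phi_tangent.
- exact: tangent0.
Qed.

(** The two ways of computing phi^3 u differ by eta(phi u) xi. *)
Lemma eta_phi p u : tangent p u -> eta p (phi p u) = 0.
Proof.
move=> tu; have tx := xi_tangent p; have tz := phi_tangent tu.
have z2 := phi_phi tz.
have z3 : phi p (phi p (phi p u)) = - phi p u.
  rewrite [phi p (phi p u)]phi_phi // addrC phi_lin ?phi_xi ?scaler0 ?add0r //.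
    by rewrite -scaleN1r phi_scale // scaleN1r.
  exact: tangentN.
have : eta p (phi p u) *: xi p = 0.
  by apply: (addrI (- phi p u)); rewrite -z2 z3 addr0.
move=> /eqP; rewrite scaler_eq0 => /orP[/eqP//|/eqP x0].
by have := eta_xi p; rewrite -(inner_xi tx) x0 (inner0l hg (tangent0 p)) => /eqP;
  rewrite eq_sym oner_eq0.
Qed.

(** Compatibility of g and phi applied to the pair (phi u, v). *)
Lemma phi_skew p u v : tangent p u -> tangent p v ->
  g p (phi p u) v = - g p u (phi p v).
Proof.
move=> tu tv; have tx := xi_tangent p; have tz := phi_tangent tu.
have tw := phi_tangent tv.
have := inner_phi tz tv.
rewrite eta_phi // mul0r subr0 => <-.
rewrite phi_phi // addrC (inner_linl hg) //; last exact: tangentN.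
rewrite (innerNl hg) // (inner_sym hg tx) // inner_xi //.
by rewrite eta_phi // mulr0 add0r.
Qed.

End AlmostContact.

(** * Local phi-frames in dimension three *)

Definition o0 : 'I_3 := @Ordinal 3 0 isT.
Definition o1 : 'I_3 := @Ordinal 3 1 isT.
Definition o2 : 'I_3 := @Ordinal 3 2 isT.

Lemma sum3 (V : nmodType) (F : 'I_3 -> V) : \sum_i F i = F o0 + F o1 + F o2.
Proof.
rewrite !big_ord_recr big_ord0 /= add0r.
by congr (F _ + F _ + F _); apply: val_inj.
Qed.

Lemma ord3P (P : 'I_3 -> Prop) : P o0 -> P o1 -> P o2 -> forall i, P i.
Proof.
move=> P0 P1 P2 [[|[|[|//]]] i3].
- by rewrite (_ : Ordinal i3 = o0) //; exact: val_inj.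
- by rewrite (_ : Ordinal i3 = o1) //; exact: val_inj.
- by rewrite (_ : Ordinal i3 = o2) //; exact: val_inj.
Qed.

Definition phi_frame (R : realType) (M : manifold R 3) (phi : tensor11 M)
  (xi e : vfield M) (i : 'I_3) : vfield M := nth xi [:: e; tapp phi e; xi] i.

Section FrameExistence.
Context {R : realType} (M : manifold R 3) (phi : tensor11 M)
  (xi : vfield M) (eta : form1 M) (g : form2 M)
  (hc : almost_contact_metric phi xi eta g).
Let hg := contact_metric hc.

Lemma phi_frame_orthonormal (U : set M) e : open U -> vfield_on U e ->
  (forall p, U p -> g p (e p) (e p) = 1) -> (forall p, U p -> eta p (e p) = 0) ->
  orthonormal_frame g U (phi_frame phi xi e).
Proof.
move=> oU ve ee ne.
have vF i : vfield_on U (phi_frame phi xi e i).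
  move: i; apply: ord3P; [exact: ve|exact: (phi_on hc oU ve)|exact: (xi_on hc)].
split=> // p Up; split=> [i|]; first by have [H _] := vF i; exact: H.
have te : tangent p (e p) by have [H _] := ve; exact: H.
have tx := xi_tangent hc p; have tf := phi_tangent hc te.
have e1 : g p (e p) (phi p (e p)) = 0.
  have := phi_skew hc te te; rewrite (inner_sym hg tf te) => E; lra.
have e2 : g p (e p) (xi p) = 0 by rewrite (inner_xi hc) // ne.
have f2 : g p (phi p (e p)) (xi p) = 0 by rewrite (inner_xi hc) // (eta_phi hc).
have ff : g p (phi p (e p)) (phi p (e p)) = 1.
  by rewrite (inner_phi hc) // ee // ne // mulr0 subr0.
have xx : g p (xi p) (xi p) = 1 by rewrite (inner_xi hc) // (eta_xi hc).
apply: ord3P; apply: ord3P; rewrite /phi_frame /tapp /= ?ee //.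
- by rewrite (inner_sym hg).
- by rewrite (inner_sym hg).
- by rewrite (inner_sym hg).
Qed.

(** Among the coordinate fields some one is not proportional to xi at p, since
    two different vectors of a basis cannot both be multiples of one vector;
    its component orthogonal to xi is taken. *)
Lemma horizontal_field p : exists (c : chart R 3 M) (Y : vfield M),
  [/\ cdom c p, vfield_on (cdom c) Y, Y p <> 0 &
      forall q, cdom c q -> eta q (Y q) = 0].
Proof.
have [c ac cp] := atlas_cover p.
pose X (j : 'I_3) := chart_field c (delta_mx ord0 j).
have vX j : vfield_on (cdom c) (X j) by exact: chart_field_on.
pose Y j : vfield M := fun q => (- eta q (X j q)) *: xi q + X j q.
have oc := @cdom_open _ _ _ c.
have vY j : vfield_on (cdom c) (Y j).
  apply: vfield_on_lin => //; last exact: (xi_on hc).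
  by apply: smoothN => //; exact: (eta_smooth hc).
have etaY j q : cdom c q -> eta q (Y j q) = 0.
  move=> cq; rewrite (eta_lin hc) ?(eta_xi hc) ?mulr1 ?addNr //.
    exact: (xi_tangent hc).
  by have [H _] := vX j; exact: H.
suff [j Yj] : exists j, Y j p <> 0 by exists c, (Y j); split=> // q; exact: etaY.
apply: contrapT => /forallNP Y0.
have [w xiE] := tangent_in_chart ac cp (xi_tangent hc p).
have XE j : delta_mx ord0 j = eta p (X j p) *: w.
  apply/eqP; rewrite -subr_eq0 addrC -scaleNr; apply/eqP.
  apply: (chart_vec_inj ac cp); rewrite chart_vec_linear // -xiE.
  exact: (contrapT (Y0 j)).
have E i j : (i == j)%:R = eta p (X j p) * w ord0 i.
  by have /matrixP/(_ ord0 i) := XE j; rewrite !mxE eqxx /=.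
(* With w the components of xi and k_j = eta(X_j): k_0 w_0 = k_1 w_1 = 1 while
   k_0 w_1 = 0, contradicting (k_1 w_0) (k_0 w_1) = (k_0 w_0) (k_1 w_1). *)
have E00 := E o0 o0; have E10 := E o1 o0; have E11 := E o1 o1.
have := congr1 (fun x => eta p (X o1 p) * w ord0 o0 * x) E10.
rewrite mulr0 (_ : _ * _ * _
  = (eta p (X o0 p) * w ord0 o0) * (eta p (X o1 p) * w ord0 o1)).
  by rewrite -E00 -E11 mulr1 => /eqP; rewrite eq_sym oner_eq0.
by ring.
Qed.

(** A horizontal field that is nonzero at p is nonzero near p by continuity,
    and can be normalised smoothly there. *)
Lemma local_phi_frame p : exists U e,
  [/\ open U, U p & orthonormal_frame g U (phi_frame phi xi e)].
Proof.
have [c [Y [cp vY Yp etaY]]] := horizontal_field p.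
have oc := @cdom_open _ _ _ c.
have sN := inner_smooth hg oc vY vY.
have tY q : cdom c q -> tangent q (Y q) by have [H _] := vY; exact: H.
have Np : 0 < f2app g Y Y p by case: hg => _ _ H _; apply: H Yp; exact: tY.
pose U := cdom c `&` [set q | 0 < f2app g Y Y q]^°.
have oU : open U by apply: openI => //; exact: open_interior.
have Uc : U `<=` cdom c by move=> q [].
have NU q : U q -> 0 < f2app g Y Y q by move=> [_ /interior_subset].
have vYU := vfield_on_sub Uc vY.
have srs : smooth U (fun q => (Num.sqrt (f2app g Y Y q))^-1).
  by apply: smooth_rsqrt => //; exact: smooth_subset sN.
have ve := vfield_on_lin oU srs vYU (vfield_on0 U).
exists U, (fun q => (Num.sqrt (f2app g Y Y q))^-1 *: Y q + 0); split=> //.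
  split=> //; rewrite /interior.
  have /(_ [set x | 0 < x]) := smooth_continuous oc cp sN; apply.
  by apply: open_nbhs_nbhs; split => //; exact: open_gt.
apply: phi_frame_orthonormal => // q Uq.
  have tq := tY q (Uc q Uq).
  rewrite addr0 (innerZl hg) // ?(inner_sym hg tq) ?(innerZl hg) //; try exact: tangentZ.
  rewrite mulrA -invfM -expr2 sqr_sqrtr; last by rewrite ltW // NU.
  by rewrite mulVf // gt_eqF // NU.
rewrite (eta_lin hc) //; [|exact: tY (Uc q Uq)|exact: tangent0].
rewrite etaY ?mulr0 ?add0r; last exact: Uc.
by rewrite -(inner_xi hc (tangent0 q)) (inner0l hg) //; exact: (xi_tangent hc).
Qed.

End FrameExistence.

(** * The connection coefficients of a phi-frame *)

Section StructureEquations.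
Context {R : realType} (M : manifold R 3) (phi : tensor11 M) (xi : vfield M)
  (eta : form1 M) (g : form2 M) (nabla : vfield M -> vfield M -> vfield M)
  (alpha : R).
Context (ha : almost_alpha_cosymplectic phi xi eta g alpha)
  (hn : levi_civita g nabla).
Context (U : set M) (e : vfield M) (sigma : M -> R) (oU : open U)
  (hF : orthonormal_frame g U (phi_frame phi xi e))
  (hh : forall p, U p -> htensor phi xi e p = sigma p *: e p).

Let hc : almost_contact_metric phi xi eta g. Proof. by case: ha. Qed.
Let hg := contact_metric hc.
Local Notation E := (phi_frame phi xi e).
Local Notation G := (christoffel g nabla E).

Let vE i : vfield_on U (E i). Proof. exact: frame_on hF i. Qed.
Let tE i p : U p -> tangent p (E i p).
Proof. by move=> Up; exact: vfield_tangent (vE i) Up. Qed.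
Let gE i j p : U p -> g p (E i p) (E j p) = (i == j)%:R.
Proof. by move=> Up; have [_ H] := frame_orthonormal hF Up; exact: H. Qed.
Let Gs i j k : smooth U (G i j k).
Proof. exact: (christoffel_smooth hg hn oU hF). Qed.

Lemma dir_cst_on X f (k : R) p : tangent p (X p) ->
  (forall q, U q -> f q = k) -> U p -> dir X f p = 0.
Proof.
move=> tX fk Up; rewrite -(tangent_cst k tX) /dir.
apply/esym; apply: (tangent_eq tX oU Up); first by move=> q /fk.
exact: smooth_cst.
Qed.

Lemma eta_frame i p : U p -> eta p (E i p) = (i == o2)%:R.
Proof. by move=> Up; rewrite -(inner_xi hc (tE i Up)); exact: (gE i o2 Up). Qed.

(** The leaves of eta = 0 have a symmetric second fundamental form: eta is
    constant on the frame, so d eta (Ei, Ej) is - eta [Ei, Ej]. *)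
Lemma christoffel_closed i j p : U p -> G i j o2 p = G j i o2 p.
Proof.
move=> Up; case: ha => _ d_eta _.
have := d_eta U _ _ oU (vE i) (vE j) p Up.
have dz k l : dir (E k) (f1app eta (E l)) p = 0.
  exact: (dir_cst_on (tE k Up) (fun q Uq => eta_frame l Uq) Up).
rewrite /d1 !dz subrr sub0r /f1app -(inner_xi hc); last first.
  exact: vfield_tangent (bracket_on hn oU (vE i) (vE j)) Up.
have := bracket_coord hg hn oU hF i j o2 Up; rewrite /f2app => -> /eqP.
by rewrite oppr_eq0 subr_eq0 => /eqP.
Qed.

Lemma christoffel_diag i j p : U p -> G i j j p = 0.
Proof. by move=> Up; have := christoffel_skew hg hn oU hF i j j Up => H; lra. Qed.

Lemma bracket_frame i j k p : U p ->
  g p (bracket (E i) (E j) p) (E k p) = G i j k p - G j i k p.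
Proof. by move=> Up; exact: (bracket_coord hg hn oU hF i j k Up). Qed.

Lemma bracket_tangent i j p : U p -> tangent p (bracket (E i) (E j) p).
Proof. by move=> Up; exact: vfield_tangent (bracket_on hn oU (vE i) (vE j)) Up. Qed.

Lemma phi_frame0 p : phi p (E o0 p) = E o1 p. Proof. by []. Qed.

Lemma phi_frame1 p : U p -> phi p (E o1 p) = - E o0 p.
Proof.
by move=> Up; rewrite (phi_phi hc) ?(eta_frame o0 Up) ?scale0r ?addr0 //; exact: (tE o0).
Qed.

Lemma phi_frame2 p : phi p (E o2 p) = 0.
Proof. exact: (phi_xi hc). Qed.

Lemma Phi_frame_cst i j : exists k, forall q, U q ->
  f2app (fundamental2 phi g) (E i) (E j) q = k.
Proof.
rewrite /f2app /fundamental2; move: i; apply: ord3P.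
- by exists (o1 == j)%:R => q Uq; rewrite phi_frame0 gE.
- exists (- (o0 == j)%:R) => q Uq.
  by rewrite phi_frame1 // (innerNl hg (tE o0 Uq) (tE j Uq)) gE.
- by exists 0 => q Uq; rewrite phi_frame2 (inner0l hg (tE j Uq)).
Qed.

(** Evaluate d Phi = 2 alpha eta /\ Phi on (e, phi e, xi). Since Phi is
    constant on the frame, only the brackets contribute, and they give the
    divergence of xi. *)
Lemma divergence_xi p : U p -> G o0 o2 o0 p + G o1 o2 o1 p = 2 * alpha.
Proof.
move=> Up; case: ha => _ _ dPhi.
have := dPhi U _ _ _ oU (vE o0) (vE o1) (vE o2) p Up.
have dz i j k : dir (E k) (f2app (fundamental2 phi g) (E i) (E j)) p = 0.
  by have [c Hc] := Phi_frame_cst i j; exact: (dir_cst_on (tE k Up) Hc Up).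
have skew i j k : f2app (fundamental2 phi g) (bracket (E i) (E j)) (E k) p
    = - g p (bracket (E i) (E j) p) (phi p (E k p)).
  exact: (phi_skew hc (bracket_tangent i j Up) (tE k Up)).
rewrite /d2 !dz !skew /wedge12 !eta_frame //= !mul0r mul1r !add0r.
rewrite /fundamental2 phi_frame0 phi_frame1 // phi_frame2 gE //= mulr1.
have tb i j := bracket_tangent i j Up.
rewrite (inner_sym hg (tb _ _) (tangent0 p)) (inner0l hg (tb _ _)).
rewrite (inner_sym hg (tb _ _) (tangentN (tE o0 Up))) (innerNl hg (tE o0 Up) (tb _ _)).
rewrite (inner_sym hg (tE o0 Up) (tb _ _)) !bracket_frame //.
have := christoffel_closed; move=> H; move: (H o2 o0 p Up) (H o2 o1 p Up).
have := christoffel_diag o2 o0 Up; have := christoffel_diag o2 o1 Up.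
by move=> ? ? ? ? ?; lra.
Qed.

(** The equation 2 h e = [xi, phi e] - phi [xi, e] has a component along e,
    which gives the off-diagonal terms together with the symmetry of
    [christoffel_closed], and a component along phi e, which says that the two
    diagonal terms are equal; their sum is known from [divergence_xi]. *)
Lemma christoffel_table p : U p ->
  [/\ G o0 o2 o0 p = alpha, G o1 o2 o1 p = alpha,
      G o0 o2 o1 p = - sigma p & G o1 o2 o0 p = - sigma p].
Proof.
move=> Up; have tb i j := bracket_tangent i j Up.
have t1 := tE o1 Up; have t0 := tE o0 Up.
(* The components of 2 h e = 2 sigma e. *)
have hE k : g p (bracket (E o2) (E o1) p) (E k p)
    - g p (phi p (bracket (E o2) (E o0) p)) (E k p)
    = 2 * (sigma p * g p (E o0 p) (E k p)).
  rewrite -(innerZl hg _ t0 (tE k Up)).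
  rewrite -(innerBl hg (tb o2 o1) (phi_tangent hc (tb o2 o0)) (tE k Up)).
  have -> : sigma p *: E o0 p
      = 2^-1 *: (bracket (E o2) (E o1) p - phi p (bracket (E o2) (E o0) p)).
    by rewrite -(hh Up).
  rewrite (innerZl hg _ _ (tE k Up)) ?mulVKf ?pnatr_eq0 //.
  apply: tangentB => //; exact: (phi_tangent hc).
have := hE o0; rewrite (phi_skew hc (tb _ _) t0) phi_frame0 !bracket_frame // gE //=.
have := hE o1; rewrite -{2}phi_frame0 (inner_phi hc (tb _ _) t0) eta_frame //.
rewrite !bracket_frame // gE //=.
rewrite mulr0 !subr0.
have := divergence_xi Up.
have cl := fun i j => christoffel_closed i j Up.
have sk := fun i j k => christoffel_skew hg hn oU hF i j k Up.
move: (christoffel_diag o2 o0 Up) (christoffel_diag o2 o1 Up) (cl o0 o1).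
move: (sk o0 o1 o2) (sk o1 o0 o2) (sk o2 o0 o1).
by split; lra.
Qed.

Lemma christoffel_xi_row i p : U p -> G i o2 o2 p = 0 /\ G o2 i o2 p = 0.
Proof.
move=> Up; rewrite (christoffel_closed o2 i Up).
by rewrite (christoffel_diag i o2 Up).
Qed.

(** The table of all connection coefficients; row i lists the components of
    nabla_Ei E0, nabla_Ei E1, nabla_Ei E2. Here a, B, w are G 0 1 0, G 1 0 1
    and G 2 0 1, so B is the opposite of b. *)
Definition christoffel_matrix (a B w s : R) : 'I_3 -> 'I_3 -> 'I_3 -> R :=
  fun i j k => nth 0 (nth [::] (nth [::]
   [:: [:: [:: 0; - a; - alpha]; [:: a; 0; s]; [:: alpha; - s; 0]];
       [:: [:: 0; B; s]; [:: - B; 0; - alpha]; [:: - s; alpha; 0]];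
       [:: [:: 0; w; 0]; [:: - w; 0; 0]; [:: 0; 0; 0]]] i) j) k.

Lemma christoffelE p i j k : U p ->
  G i j k p = christoffel_matrix (G o0 o1 o0 p) (G o1 o0 o1 p) (G o2 o0 o1 p)
    (sigma p) i j k.
Proof.
move=> Up; have [T1 T2 T3 T4] := christoffel_table Up.
have sk := fun i j k => christoffel_skew hg hn oU hF i j k Up.
have dg := fun i j => christoffel_diag i j Up.
have xr := fun i => christoffel_xi_row i Up.
move: i j k; apply: ord3P; apply: ord3P; apply: ord3P; rewrite /christoffel_matrix /=;
  rewrite ?dg ?(proj1 (xr _)) ?(proj2 (xr _)) ?T1 ?T2 ?T3 ?T4 //.
all: by rewrite sk ?(proj2 (xr _)) ?T1 ?T2 ?T3 ?T4 ?opprK ?oppr0.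
Qed.

(** A form of [christoffelE] with no connection coefficient on the right-hand
    side, so that it can be used as a terminating rewrite rule. *)
Lemma christoffel_values p : U p -> exists a B w : R, forall i j k,
  G i j k p = christoffel_matrix a B w (sigma p) i j k.
Proof.
move=> Up; exists (G o0 o1 o0 p), (G o1 o0 o1 p), (G o2 o0 o1 p) => i j k.
exact: christoffelE.
Qed.

Lemma dir_christoffel_cst i j k l (c : R) p :
  (forall q, U q -> G j k l q = c) -> U p -> dir (E i) (G j k l) p = 0.
Proof. by move=> Gc Up; exact: (dir_cst_on (tE i Up) Gc Up). Qed.

Lemma dir_christoffel_skew i j k l p : U p ->
  dir (E i) (G j k l) p = - dir (E i) (G j l k) p.
Proof.
move=> Up; rewrite /dir -(tangent_opp (tE i Up) oU Up (Gs j l k)).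
apply: (tangent_eq (tE i Up) oU Up _ (Gs j k l)) => q Uq.
exact: (christoffel_skew hg hn oU hF).
Qed.

(** * The soliton equation in a phi-frame *)

Section Soliton.
Context (S : form2 M) (r : M -> R) (lambda : R).
Context (hS : ricci_tensor g nabla S) (hr : scalar_curvature g S r)
  (hs : einstein_soliton g S r xi lambda).

(** Since g is constant on the frame, the Lie derivative of g along xi reduces
    to brackets, i.e. to twice the symmetric part of nabla xi. *)
Lemma soliton_frame i j p : U p ->
  G i o2 j p + G j o2 i p + 2 * S p (E i p) (E j p)
  = (2 * lambda + r p) * (i == j)%:R.
Proof.
move=> Up; have := hs oU (vE i) (vE j) Up; rewrite /lie_form2.
have -> : dir xi (f2app g (E i) (E j)) p = 0.
  exact: (dir_cst_on (tE o2 Up) (fun q Uq => gE i j Uq) Up).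
rewrite /f2app gE // => <-.
rewrite (inner_sym hg (tE i Up) (bracket_tangent o2 j Up)).
rewrite -[xi]/(E o2) !bracket_frame //.
have := christoffel_skew hg hn oU hF o2 i j Up => H.
by rewrite sub0r H; ring.
Qed.

Lemma ricci_frame i j p : U p -> S p (E i p) (E j p) =
  \sum_n ((dir (E n) (G i j n) p - \sum_k G i j k p * G n n k p)
    - (dir (E i) (G n j n) p - \sum_k G n j k p * G i n k p)
    - \sum_k (G n i k p - G i n k p) * G k j n p).
Proof.
move=> Up; rewrite (hS oU hF (vE i) (vE j) Up).
by apply: eq_bigr => n _; rewrite (curvature_coord hg hn oU hF).
Qed.

Lemma soliton_trace p : U p -> r p = 4 * alpha - 6 * lambda.
Proof.
move=> Up; have [a [B [w tab]]] := christoffel_values Up.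
have := hr (frame_orthonormal hF Up); rewrite sum3.
have := soliton_frame o0 o0 Up; have := soliton_frame o1 o1 Up.
have := soliton_frame o2 o2 Up; rewrite !tab /christoffel_matrix /=.
move: (S p _ _) (S p _ _) (S p _ _) => *; lra.
Qed.

(** The derivatives that occur are those of the constants 0 and alpha. *)
Lemma ricci_xi p : U p -> S p (E o2 p) (E o2 p) = - 2 * (alpha ^+ 2 + sigma p ^+ 2).
Proof.
move=> Up; have [a [B [w tab]]] := christoffel_values Up.
rewrite ricci_frame // !sum3 !tab /christoffel_matrix /=.
have T := christoffel_table.
rewrite (@dir_christoffel_cst o0 o2 o2 o0 0) //; last first.
  by move=> q /(christoffelE _ _ _) ->.
rewrite (@dir_christoffel_cst o1 o2 o2 o1 0) //; last first.
  by move=> q /(christoffelE _ _ _) ->.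
rewrite (@dir_christoffel_cst o2 o0 o2 o0 alpha) //; last first.
  by move=> q /T[].
rewrite (@dir_christoffel_cst o2 o1 o2 o1 alpha) //; last first.
  by move=> q /T[].
by ring.
Qed.

(** By the antisymmetries of the curvature the left-hand side is twice the
    sectional curvature of the plane of e and phi e. No derivative of sigma
    occurs. *)
Lemma ricci_horizontal p : U p ->
  S p (E o0 p) (E o0 p) + S p (E o1 p) (E o1 p) - S p (E o2 p) (E o2 p)
  = - 2 * (dir (E o1) (G o0 o1 o0) p + dir (E o0) (G o1 o0 o1) p
     + G o0 o1 o0 p ^+ 2 + G o1 o0 o1 p ^+ 2 + alpha ^+ 2 - sigma p ^+ 2).
Proof.
move=> Up; have [a [B [w tab]]] := christoffel_values Up.
rewrite ricci_xi // !ricci_frame // !sum3.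
rewrite !tab /christoffel_matrix /=.
rewrite (@dir_christoffel_skew o1 o0 o0 o1) // (@dir_christoffel_skew o0 o1 o1 o0) //.
rewrite (@dir_christoffel_cst o2 o0 o0 o2 (- alpha)) //; last first.
  by move=> q /(christoffelE _ _ _) ->.
rewrite (@dir_christoffel_cst o2 o1 o1 o2 (- alpha)) //; last first.
  by move=> q /(christoffelE _ _ _) ->.
rewrite (@dir_christoffel_cst o0 o2 o0 o2 0) //; last first.
  by move=> q /(christoffelE _ _ _) ->.
rewrite (@dir_christoffel_cst o1 o2 o1 o2 0) //; last first.
  by move=> q /(christoffelE _ _ _) ->.
by ring.
Qed.

Lemma soliton_identity p : U p ->
  alpha = G o0 o1 o0 p ^+ 2 + G o1 o0 o1 p ^+ 2 - 2 * sigma p ^+ 2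
          + dir (E o1) (G o0 o1 o0) p + dir (E o0) (G o1 o0 o1) p.
Proof.
move=> Up; have [a [B [w tab]]] := christoffel_values Up.
have := ricci_horizontal Up; have := ricci_xi Up.
have := soliton_trace Up.
have := soliton_frame o0 o0 Up; have := soliton_frame o1 o1 Up.
have := soliton_frame o2 o2 Up; rewrite !tab /christoffel_matrix /=.
move: (S p _ _) (S p _ _) (S p _ _) => *; lra.
Qed.

(** * The case h = 0 *)

Section Normal.
Context (sigma0 : forall q, U q -> sigma q = 0).

(** These are the equations S(xi, phi e) = 0 and S(xi, e) = 0. *)
Lemma xi_connection_coef p : U p ->
  dir (E o2) (G o0 o1 o0) p
    = - alpha * G o0 o1 o0 p - G o1 o0 o1 p * G o2 o0 o1 p - dir (E o0) (G o2 o0 o1) p /\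
  dir (E o2) (G o1 o0 o1) p
    = - alpha * G o1 o0 o1 p + G o0 o1 o0 p * G o2 o0 o1 p + dir (E o1) (G o2 o0 o1) p.
Proof.
move=> Up; have [a [B [w tab]]] := christoffel_values Up.
have dg i j k : dir (E i) (G j k k) p = 0.
  by apply: dir_christoffel_cst Up => q Uq; exact: christoffel_diag.
have := soliton_frame o2 o0 Up; have := soliton_frame o2 o1 Up.
rewrite !ricci_frame // !sum3 !dg (@dir_christoffel_skew o0 o2 o1 o0) //.
rewrite !tab (sigma0 Up) /christoffel_matrix /= => ? ?.
by split; lra.
Qed.

(** Differentiate along xi the identity [soliton_identity], whose left-hand
    side is constant: commuting xi past e and phi e and substituting
    [xi_connection_coef] leaves - 2 alpha times its right-hand side, i.e. - 2
    alpha^2. *)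
Lemma alpha_eq0 p : U p -> alpha = 0.
Proof.
move=> Up; pose A := G o0 o1 o0; pose B := G o1 o0 o1; pose w := G o2 o0 o1.
have sA : smooth U A by exact: Gs.
have sB : smooth U B by exact: Gs.
have sw : smooth U w by exact: Gs.
have sD i f : smooth U f -> smooth U (dir (E i) f).
  by move=> sf; have [_ H] := vE i; exact: H.
have dirD i f f' : smooth U f -> smooth U f' ->
    dir (E i) (fun q => f q + f' q) p = dir (E i) f p + dir (E i) f' p.
  exact: (tangent_add (tE i Up) oU Up).
have dirM i f f' : smooth U f -> smooth U f' ->
    dir (E i) (fun q => f q * f' q) p = f p * dir (E i) f' p + f' p * dir (E i) f p.
  exact: (tangent_mul (tE i Up) oU Up).
have dirK i (k : R) f : smooth U f -> dir (E i) (fun q => k * f q) p = k * dir (E i) f p.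
  move=> sf; rewrite dirM //; last exact: smooth_cst.
  by rewrite [X in _ + _ * X](tangent_cst k (tE i Up)) mulr0 addr0.
have sM f f' : smooth U f -> smooth U f' -> smooth U (fun q => f q * f' q).
  exact: smoothM.
have sP f f' : smooth U f -> smooth U f' -> smooth U (fun q => f q + f' q).
  exact: smoothD.
have sK k f : smooth U f -> smooth U (fun q => k * f q).
  by move=> sf; apply: smoothM => //; exact: smooth_cst.
have sBw := sM _ _ sB sw; have sAw := sM _ _ sA sw.
have sKA := sK (- alpha) _ sA; have sKB := sK (- alpha) _ sB.
have sKBw := sK (-1) _ sBw.
have sKw := sK (-1) _ (sD o0 _ sw).
have [xA xB] := xi_connection_coef Up.
have K0 : 2 * A p * dir (E o2) A p + 2 * B p * dir (E o2) B p
    + (dir (E o2) (dir (E o1) A) p + dir (E o2) (dir (E o0) B) p) = 0.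
  transitivity (dir (E o2) (fun q => (A q * A q + B q * B q)
      + (dir (E o1) A q + dir (E o0) B q)) p).
    rewrite dirD; first last.
    - exact: sP (sD _ _ sA) (sD _ _ sB).
    - exact: sP (sM _ _ sA sA) (sM _ _ sB sB).
    rewrite (dirD _ _ _ (sM _ _ sA sA) (sM _ _ sB sB)).
    rewrite (dirD _ _ _ (sD o1 _ sA) (sD o0 _ sB)).
    by rewrite !dirM //; ring.
  apply: (dir_cst_on (k := alpha) (tE o2 Up)) Up => q Uq.
  rewrite (soliton_identity Uq) (sigma0 Uq) -/A -/B; ring.
have dxA : dir (E o1) (dir (E o2) A) p = - alpha * dir (E o1) A p
    - (B p * dir (E o1) w p + w p * dir (E o1) B p) - dir (E o1) (dir (E o0) w) p.
  transitivity (dir (E o1)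
    (fun q => (- alpha * A q + -1 * (B q * w q)) + -1 * dir (E o0) w q) p).
    apply: (tangent_eq (tE o1 Up) oU Up _ (sD _ _ sA)) => q Uq.
    by have [-> _] := xi_connection_coef Uq; rewrite -/A -/B -/w; ring.
  rewrite dirD ?dirD ?dirK ?dirM //; [by ring|exact: sD|exact: sP].
have dxB : dir (E o0) (dir (E o2) B) p = - alpha * dir (E o0) B p
    + (A p * dir (E o0) w p + w p * dir (E o0) A p) + dir (E o0) (dir (E o1) w) p.
  transitivity (dir (E o0) (fun q => (- alpha * B q + A q * w q) + dir (E o1) w q) p).
    apply: (tangent_eq (tE o0 Up) oU Up _ (sD _ _ sB)) => q Uq.
    by have [_ ->] := xi_connection_coef Uq.
  rewrite dirD ?dirD ?dirK ?dirM //; [exact: sP|exact: sD].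
have cA := frame_commutator hg hn oU hF o2 o1 sA Up.
have cB := frame_commutator hg hn oU hF o2 o0 sB Up.
have cw := frame_commutator hg hn oU hF o1 o0 sw Up.
have Ka := soliton_identity Up.
have tab : forall i j k, G i j k p = christoffel_matrix (A p) (B p) (w p) 0 i j k.
  by move=> i j k; rewrite christoffelE // (sigma0 Up).
(* The last step is linear in the monomials once this product is supplied. *)
have Ka2 : alpha * alpha = alpha * (A p ^+ 2 + B p ^+ 2 - 2 * 0 ^+ 2
          + dir (E o1) A p + dir (E o0) B p) by rewrite {2}Ka (sigma0 Up).
move: K0 cA cB cw; rewrite dxA dxB xA xB !sum3 !tab /christoffel_matrix /=.
rewrite -/A -/B -/w xA xB => K0 cA cB cw.
have /eqP : alpha * alpha = 0 by lra.
by rewrite mulf_eq0 orbb => /eqP.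
Qed.

End Normal.

End Soliton.

End StructureEquations.

(** * Contact Einstein solitons on almost alpha-cosymplectic 3-manifolds *)

Theorem theorem3p4 (R : realType) (M : manifold R 3)
    (phi : tensor11 M) (xi : vfield M) (eta : form1 M) (g : form2 M)
    (nabla : vfield M -> vfield M -> vfield M) (S : form2 M) (r : M -> R)
    (alpha lambda : R) :
  almost_alpha_cosymplectic phi xi eta g alpha ->
  levi_civita g nabla ->
  ricci_tensor g nabla S ->
  scalar_curvature g S r ->
  contact_einstein_soliton g S r xi lambda ->
  (forall (U : set M) (e : vfield M) (sigma : M -> R),
     phi_basis phi xi g U e sigma ->
     let phie := tapp phi e in
     let a := f2app g (nabla e phie) e in
     let b := fun q : M => - f2app g (nabla phie e) phie q in
     forall p : M, U p -> sigma p != 0 ->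
       alpha = a p ^+ 2 + b p ^+ 2 - 2 * sigma p ^+ 2
               + dir phie a p - dir e b p) /\
  ((forall (U : set M) (X : vfield M), open U -> vfield_on U X ->
      forall p : M, U p -> htensor phi xi X p = 0) ->
   cosymplectic3 phi xi eta g).
Proof.
move=> ha hn hS hr hs; have [hc d_eta dPhi] := ha; have hg := contact_metric hc.
split=> [U e sigma [oU hF _ hh] phie a b p Up _|h0].
  have hh' q : U q -> htensor phi xi e q = sigma q *: e q by move=> /hh[].
  rewrite (soliton_identity ha hn oU hF hh' hS hr hs Up).
  have [vE _] := hF.
  have sB := christoffel_smooth hg hn oU hF o1 o0 o1.
  have te : tangent p (e p) := vfield_tangent (vE o0) Up.
  have -> : dir e b p = - dir e (christoffel g nabla (phi_frame phi xi e) o1 o0 o1) p.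
    exact: (tangent_opp te oU Up sB).
  by rewrite opprK /b sqrrN.
have alpha0 (p : M) : alpha = 0.
  have [U [e [oU Up hF]]] := local_phi_frame hc p.
  have hh q : U q -> htensor phi xi e q = 0 *: e q.
    by move=> Uq; rewrite scale0r; apply: (h0 U) => //; exact: hF.1 o0.
  exact: (alpha_eq0 ha hn oU hF hh hS hr hs (fun _ _ => erefl) Up).
split=> // [U X Y Z oU vX vY vZ p Up|p].
  by rewrite (dPhi U X Y Z) // (alpha0 p) mulr0 mul0r.
have [U [e [oU Up hF]]] := local_phi_frame hc p.
have [tE gE] := frame_orthonormal hF Up.
exists (e p), (phi p (e p)), (xi p).
split; [exact: (tE o0)|exact: (tE o1)|exact: (tE o2)|].
have e0 : eta p (e p) = 0 by rewrite -(inner_xi hc (tE o0)); exact: (gE o0 o2).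
have e1 : eta p (phi p (e p)) = 0 := eta_phi hc (tE o0).
have Phi01 : g p (phi p (e p)) (phi p (e p)) = 1 := gE o1 o1.
rewrite /wedge12 /fundamental2 e0 e1 (eta_xi hc) Phi01.
by rewrite !mul0r !add0r mulr1 oner_neq0.
Qed.
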